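(* Let $A \in \mathcal{H}_{\alpha}(\mathbb{R}^{\mathbb{N}})$. Then: (a) There exist $\lambda_A > 0$ and a strictly positive $\alpha$-Hölder continuous function $\psi_A : \mathbb{R}^{\mathbb{N}} \to \mathbb{R}$ such that $\mathcal{L}_A(\psi_A)(x) = \lambda_A \psi_A(x)$ for all $x \in \mathbb{R}^{\mathbb{N}}$. Moreover, this main eigenvalue $\lambda_A$ is simple. (b) Setting $\bar{A} = A + \log(\psi_A) - \log(\psi_A \circ \sigma) - \log(\lambda_A)$, there is a unique fixed point $\mu_A$ of $\mathcal{L}^*_{\bar{A}}$ which belongs to $\mathcal{M}_\sigma(\mathbb{R}^{\mathbb{N}})$ (it is called the Gibbs state associated to $A$). (c) Choosing the eigenfunction $\psi_A$ adequately (i.e. a suitable positive multiple), the measure $\rho_A$ defined by $d\rho_A = \frac{1}{\psi_A}\, d\mu_A$ is a probability measure satisfying $\mathcal{L}^*_{A}\rho_A = \lambda_A\rho_A$ (it is called the conformal probability measure for $A$). (d) With $\psi_A$ and $\rho_A$ as in (c), for any $w \in \mathcal{H}_{\alpha}(\mathbb{R}^{\mathbb{N}})$ the following limits exist uniformly on $\mathbb{R}^{\mathbb{N}}$: $$\lim_{n\to\infty} \mathcal{L}^n_{\bar{A}}w = \int_{\mathbb{R}^{\mathbb{N}}}w \, d\mu_A \qquad\text{and}\qquad \lim_{n\to\infty} \frac{\mathcal{L}^n_{A}w}{\lambda^n_A} = \psi_A\int_{\mathbb{R}^{\mathbb{N}}}w \, d\rho_A .$$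
   Context: Points of $\mathbb{R}^{\mathbb{N}}$ are $x=(x_1,x_2,\ldots)$; $\sigma(x_1,x_2,\ldots)=(x_2,x_3,\ldots)$ is the shift; for $a\in\mathbb{R}$, $ax=(a,x_1,x_2,\ldots)$. The metric on $\mathbb{R}^{\mathbb{N}}$ is $d(x,y)=\sum_{n\ge 1}\frac{1}{\pi 2^n}|\arctan(x_n)-\arctan(y_n)|$. $\mathcal{H}_\alpha(\mathbb{R}^{\mathbb{N}})$ is the set of real-valued $\alpha$-Hölder continuous functions for $d$ (exponent $\alpha\in(0,1]$ fixed); such functions are bounded since $d$ is bounded. $\mathcal{C}_b(\mathbb{R}^{\mathbb{N}})$ is the set of bounded continuous real functions. $\mathcal{M}_\sigma(\mathbb{R}^{\mathbb{N}})$ is the set of $\sigma$-invariant Borel probability measures on $\mathbb{R}^{\mathbb{N}}$. Fix a strictly positive continuous $f:\mathbb{R}\to\mathbb{R}$ with $\int_{\mathbb{R}} f(a)\,da=1$ (the a priori probability is $d\nu=f\,dx$). The Ruelle operator of $A\in\mathcal{H}_\alpha(\mathbb{R}^{\mathbb{N}})$ is $\mathcal{L}_A(\varphi)(x)=\int_{\mathbb{R}} e^{A(ax)}\varphi(ax)f(a)\,da$; it maps $\mathcal{C}_b(\mathbb{R}^{\mathbb{N}})$ into itself and $\mathcal{H}_\alpha(\mathbb{R}^{\mathbb{N}})$ into itself. Its dual acts on finite Borel measures by $\int\varphi\, d(\mathcal{L}_A^*\mu)=\int\mathcal{L}_A(\varphi)\,d\mu$ for all $\varphi\in\mathcal{C}_b(\mathbb{R}^{\mathbb{N}})$.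 *)

(* Defs.v *)
From HB Require Import structures.
From mathcomp Require Import all_boot all_order all_algebra.
From mathcomp Require Import all_classical all_reals all_analysis.

Set Implicit Arguments.
Unset Strict Implicit.
Unset Printing Implicit Defensive.

Import Order.TTheory GRing.Theory Num.Theory.
Import numFieldNormedType.Exports.

Local Open Scope classical_set_scope.
Local Open Scope ring_scope.

(* An alias of [nat -> R], so that its topology is the one of [rseq_dist].
   The coordinate x_(n+1) of the informal text is [x n]. *)
Definition rseq (R : realType) : Type := nat -> R.

HB.instance Definition _ (R : realType) := gen_eqMixin (rseq R).
HB.instance Definition _ (R : realType) := gen_choiceMixin (rseq R).
HB.instance Definition _ (R : realType) :=
  isPointed.Build (rseq R) (fun=> 0).

Section rseq_metric.
Context {R : realType}.
Implicit Types x y z : rseq R.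

Definition rseq_dist_term x y (n : nat) : R :=
  (pi * 2 ^+ n.+1)^-1 * `|atan (x n) - atan (y n)|.

Definition rseq_dist x y : R := limn (series (rseq_dist_term x y)).

Let weight_gt0 n : 0 < (pi * 2 ^+ n.+1)^-1 :> R.
Proof. by rewrite invr_gt0 mulr_gt0 ?pi_gt0 ?exprn_gt0. Qed.

Let term_ge0 x y n : 0 <= rseq_dist_term x y n.
Proof. by rewrite mulr_ge0 ?(ltW (weight_gt0 n)). Qed.

Let cvg_dist x y : cvgn (series (rseq_dist_term x y)).
Proof.
have g1 : `|2^-1 : R| < 1.
  by rewrite ger0_norm ?invr_ge0// invf_lt1// ltr1n.
apply: (series_le_cvg _ _ _ (@is_cvg_geometric_series R 2^-1 2^-1 g1)) => n.
- exact: term_ge0.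
- by rewrite /geometric/= mulr_ge0// ?exprn_ge0 ?invr_ge0.
rewrite /geometric/= -exprS exprVn /rseq_dist_term invfM mulrAC.
rewrite ler_piMl ?invr_ge0 ?exprn_ge0// mulrC ler_pdivrMr ?pi_gt0// mul1r.
have := (atan_gtNpi2 (x n), atan_ltpi2 (x n)).
have := (atan_gtNpi2 (y n), atan_ltpi2 (y n)) => -[/= y1 y2] [x1 x2].
rewrite [leRHS](splitr pi) ler_norml opprD; apply/andP; split.
  by rewrite lerD ?lerN2 ?ltW.
by rewrite lerD ?ltW// ltrNl.
Qed.

Lemma rseq_distxx x : rseq_dist x x = 0.
Proof.
rewrite /rseq_dist (_ : series _ = cst 0) ?lim_cst//.
by apply/funext => n; rewrite /series/= big1// => i _;
  rewrite /rseq_dist_term subrr normr0 mulr0.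
Qed.

Lemma rseq_dist_eq0 x y : rseq_dist x y = 0 -> x = y.
Proof.
move=> d0; apply/funext => n.
have : rseq_dist_term x y n <= 0.
  have nd : nondecreasing_seq (series (rseq_dist_term x y)).
    by apply: nondecreasing_series => k _ _; exact: term_ge0.
  have := nondecreasing_cvgn_le nd (@cvg_dist x y) n.+1.
  rewrite -/(rseq_dist x y) d0; apply: le_trans.
  by rewrite seriesEnat/= big_nat_recr//= lerDr sumr_ge0.
rewrite pmulr_rle0// normr_le0 subr_eq0 => /eqP.
exact: (can_inj (@atanK R)).
Qed.

Lemma rseq_dist_sym x y : rseq_dist x y = rseq_dist y x.
Proof.
by congr (limn (series _)); apply/funext => n; rewrite /rseq_dist_term distrC.
Qed.

Lemma rseq_dist_triangle y x z :
  rseq_dist x z <= rseq_dist x y + rseq_dist y z.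
Proof.
rewrite /rseq_dist -lim_seriesD; [|exact: cvg_dist|exact: cvg_dist].
apply: lim_series_le => [||n]; first exact: cvg_dist.
  by apply: is_cvg_seriesD; exact: cvg_dist.
by rewrite /= -mulrDr ler_pM2l// ler_distD.
Qed.

End rseq_metric.

HB.instance Definition _ (R : realType) := @isMetric.Build R (rseq R)
  rseq_dist rseq_distxx rseq_dist_eq0 rseq_dist_sym rseq_dist_triangle.

(* Measurable sets are the Borel sets of the metric topology. *)
HB.instance Definition _ (R : realType) := Measurable.copy (rseq R)
  (g_sigma_algebraType (@open (rseq R))).

Definition shift (R : realType) (x : rseq R) : rseq R := fun n => x n.+1.

Definition prepend (R : realType) (a : R) (x : rseq R) : rseq R :=
  fun n => if n is m.+1 then x m else a.

Definition holder (R : realType) (M : metricType R) (alpha : R) :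
    set (M -> R) :=
  [set g | exists C : R, forall x y, `|g x - g y| <= C * mdist x y `^ alpha].

Definition bounded_continuous (R : realType) (T : topologicalType) :
    set (T -> R) :=
  [set g | continuous g /\ bounded_fun g].

Definition shift_invariant (R : realType) (mu : probability (rseq R) R) :=
  forall B, measurable B -> pushforward mu (@shift R) B = mu B.

Section ruelle.
Context {R : realType} (f : R -> R).

Definition ruelle (A phi : rseq R -> R) : rseq R -> R := fun x =>
  \int[lebesgue_measure]_a
    (expR (A (prepend a x)) * phi (prepend a x) * f a).

(* [mu'] is the image of [mu] under the dual of [ruelle A]. *)
Definition ruelle_dual (A : rseq R -> R)
    (mu mu' : {finite_measure set (rseq R) -> \bar R}) :=
  forall phi : rseq R -> R, bounded_continuous phi ->
    (\int[mu']_x (phi x)%:E = \int[mu]_x (ruelle A phi x)%:E)%E.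

End ruelle.

(* Algebraic multiplicity one, for an operator on bounded continuous functions:
   the union of the kernels of the powers of [L - lam] is a line. *)
Definition simple_eigenvalue (R : realType) (T : topologicalType)
    (L : (T -> R) -> (T -> R)) (lam : R) :=
  exists psi : T -> R, [/\ bounded_continuous psi, psi <> cst 0 &
    forall phi : T -> R, bounded_continuous phi ->
      (exists k : nat, iter k (fun h => L h - lam *: h) phi = cst 0) <->
      (exists c : R, phi = c *: psi)].

Definition normalized_potential (R : realType) (A : rseq R -> R)
    (lam : R) (psi : rseq R -> R) : rseq R -> R :=
  fun x => A x + ln (psi x) - ln (psi (shift x)) - ln lam.

(* Main.v *)
Require Import Defs.
From HB Require Import structures.
From mathcomp Require Import all_boot all_order all_algebra.
From mathcomp Require Import all_classical all_reals all_analysis.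
From mathcomp Require Import measurable_realfun.
From mathcomp Require Import ring lra.
Set Implicit Arguments.
Unset Strict Implicit.
Unset Printing Implicit Defensive.
Import Order.TTheory GRing.Theory Num.Theory.
Import numFieldNormedType.Exports.
Local Open Scope classical_set_scope.
Local Open Scope ring_scope.

(** The Ruelle operator [L] maps the cone of positive functions [u] with
    [u x <= exp (B * d(x, y)^alpha) * u y] into a strictly smaller cone of the
    same kind, because prepending a symbol halves the distance. In the smaller
    cone one can subtract from [u] a fixed proportion of any other element [w]
    and stay in the larger cone; iterating, [L^n u / L^n w] becomes constant
    geometrically fast. With [w = 1] this makes the normalized iterates of [1]
    converge to the eigenfunction [psi], and with [w = psi] it makes the
    iterates of the normalized (Markov) operator [P] on a Hölder function [g]
    converge uniformly to a constant [l g].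

    The functional [l] is positive and [P]-invariant. Its one-dimensional
    marginals have bounded density with respect to [f da], so it is tight, and
    Daniell's construction represents it by a probability [mu], the Gibbs state.
    A bounded continuous function is the increasing limit of its Lipschitz
    regularizations, both from below and, after a change of sign, from above:
    this extends [l (P g) = l g] to all bounded continuous functions, and shows
    that a bounded continuous fixed point of [P] is constant, whence the
    simplicity of the eigenvalue. The conformal measure has density
    [1 / (c * psi)] with respect to [mu]. *)

(** * The metric space of sequences *)

(** The alphabet is the whole line, so the space of sequences is not compact, and compactness
    arguments (Schauder, Riesz) do not apply directly. Two facts stand in for compactness. First,
    [hdist] is at most 1, so any two values of a function in a cone of exponent [B] differ by a
    factor at most [expR B]: a Harnack inequality on the whole space. Second, a positive functional
    could lose mass where a coordinate runs to infinity; since [f da] is a probability and the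
    potential is bounded, the same tails control every coordinate. The arctangent in the metric
    makes cut-offs near infinity Lipschitz.

    Invariance is first known for Hölder functions only, while the dual operator is tested on all
    bounded continuous ones. These are in general not uniform limits of Hölder functions; monotone
    pointwise limits and dominated convergence are used instead. *)

Section rseq_metric_theory.
Context {R : realType}.
Implicit Types x y z : rseq R.

Lemma norm_atanB (a b : R) : `|atan a - atan b| <= pi.
Proof.
have := (atan_gtNpi2 a, atan_ltpi2 a); have := (atan_gtNpi2 b, atan_ltpi2 b).
by move=> [/= b1 b2] [a1 a2]; rewrite ler_norml; apply/andP; split; lra.
Qed.

Lemma rseq_dist_term_ge0 x y n : 0 <= rseq_dist_term x y n.
Proof. by rewrite mulr_ge0// invr_ge0 mulr_ge0 ?pi_ge0 ?exprn_ge0. Qed.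

Lemma rseq_dist_term_le x y n : rseq_dist_term x y n <= 2^-1 ^+ n.+1.
Proof.
rewrite /rseq_dist_term invfM exprVn mulrAC ler_piMl ?invr_ge0 ?exprn_ge0//.
by rewrite mulrC ler_pdivrMr ?pi_gt0// mul1r norm_atanB.
Qed.

Lemma series_rseq_dist_le x y n :
  series (rseq_dist_term x y) n <= 1 - 2^-1 ^+ n.
Proof.
elim: n => [|n IH]; first by rewrite /series/= big_geq// expr0 subrr.
rewrite /series/= big_nat_recr//= (le_trans (lerD IH (rseq_dist_term_le _ _ _)))//.
by rewrite exprS; lra.
Qed.

Lemma nd_series_rseq_dist x y : nondecreasing_seq (series (rseq_dist_term x y)).
Proof. by apply: nondecreasing_series => k _ _; exact: rseq_dist_term_ge0. Qed.

Lemma is_cvg_rseq_dist x y : cvgn (series (rseq_dist_term x y)).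
Proof.
apply: nondecreasing_is_cvgn; first exact: nd_series_rseq_dist.
by exists 1 => _ [n _ <-]; rewrite (le_trans (series_rseq_dist_le _ _ _)).
Qed.

Lemma rseq_mdist_le1 x y : mdist x y <= 1.
Proof.
apply: limr_le; first exact: is_cvg_rseq_dist.
by near=> n; rewrite (le_trans (series_rseq_dist_le _ _ _))// lerBlDr lerDl exprn_ge0.
Unshelve. all: by end_near. Qed.

Lemma rseq_mdist_recl x y : mdist x y =
  (pi * 2)^-1 * `|atan (x 0%N) - atan (y 0%N)| + 2^-1 * mdist (Defs.shift x) (Defs.shift y).
Proof.
apply/cvg_lim => //; rewrite -(cvg_shiftn 1)/=.
have -> : (fun n => series (rseq_dist_term x y) (n + 1)%N) =
  (fun n => (pi * 2)^-1 * `|atan (x 0%N) - atan (y 0%N)| +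
      2^-1 * series (rseq_dist_term (Defs.shift x) (Defs.shift y)) n).
  apply/funext => n; rewrite addn1 /series/= big_nat_recl//= mulr_sumr.
  congr (_ + _); apply: eq_bigr => i _.
  by rewrite /rseq_dist_term [2 ^+ i.+2]exprS [pi * _]mulrCA invfM mulrA.
by apply: cvgD; [exact: cvg_cst|apply: cvgM; [exact: cvg_cst|exact: is_cvg_rseq_dist]].
Qed.

Lemma rseq_mdist_prepend a b x y : mdist (prepend a x) (prepend b y) =
  (pi * 2)^-1 * `|atan a - atan b| + 2^-1 * mdist x y.
Proof. by rewrite rseq_mdist_recl. Qed.

Lemma rseq_mdist_prependr a x y :
  mdist (prepend a x) (prepend a y) = 2^-1 * mdist x y.
Proof. by rewrite rseq_mdist_prepend subrr normr0 mulr0 add0r. Qed.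

Lemma rseq_mdist_shift x y : mdist (Defs.shift x) (Defs.shift y) <= 2 * mdist x y.
Proof.
have : 0 <= (pi * 2)^-1 * `|atan (x 0%N) - atan (y 0%N)|.
  by rewrite mulr_ge0// invr_ge0 mulr_ge0 ?pi_ge0.
by rewrite (rseq_mdist_recl x y); lra.
Qed.

Lemma norm_atan_coord x y i :
  `|atan (x i) - atan (y i)| <= pi * 2 ^+ i.+1 * mdist x y.
Proof.
have p2 : 0 < pi * 2 :> R by rewrite mulr_gt0 ?pi_gt0.
elim: i x y => [|i IH] x y.
  rewrite expr1 -ler_pdivrMl// rseq_mdist_recl lerDl mulr_ge0//.
  exact: mdist_ge0.
apply: le_trans (IH (Defs.shift x) (Defs.shift y)) _.
rewrite [2 ^+ i.+2]exprSr mulrA -(mulrA _ 2) ler_wpM2l ?rseq_mdist_shift//.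
by rewrite mulr_ge0 ?pi_ge0.
Qed.

Lemma rseq_mdist_tail x y n : (forall i, (i < n)%N -> x i = y i) ->
  mdist x y <= 2^-1 ^+ n.
Proof.
elim: n x y => [|n IH] x y xy; first by rewrite expr0 rseq_mdist_le1.
rewrite rseq_mdist_recl xy// subrr normr0 mulr0 add0r exprS ler_pM2l//.
by apply: IH => i ni; rewrite /Defs.shift xy.
Qed.

(** The coordinates from the [n]-th on contribute at most [2^-n]. Stating this for filters allows a
    comparison with the product topology, where compactness is available. *)
Lemma cvg_rseq (x : rseq R) (F : set_system (rseq R)) : Filter F ->
  (forall i, (fun y : rseq R => y i) @ F --> x i) -> F --> x.
Proof.
move=> FF Fx; apply/metricType_numDomainType.fcvgrPdist_lt => e e0.
have [n ne] : exists n, 2^-1 ^+ n < e / 2 :> R.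
  have : \forall n \near \oo, `|2^-1 ^+ n| < e / 2 :> R.
    have := @cvg_expr R 2^-1.
    rewrite ger0_norm ?invr_ge0// invf_lt1// ltr1n => /(_ isT).
    by move=> /cvgr0_norm_lt/(_ (e / 2)); apply; rewrite divr_gt0.
  by move=> [n _ /(_ n (leqnn _))/=]; rewrite ger0_norm ?exprn_ge0//; exists n.
suff : \forall y \near F, mdist x y <= 2^-1 ^+ n + e / 4.
  apply: filterS => y /le_lt_trans; apply.
  by move: ne e0; lra.
have {ne} : 0 < e / 4 by rewrite divr_gt0.
move: (e / 4) => {}e {}e0.
(* The filter is generalized because the tail of [y] converges along the image of [F] under the
   shift. The slack [e] reproduces itself: the first coordinate and the halved tail each use
   [e / 2]. *)
elim: n x F FF Fx e e0 => [|n IH] x F FF Fx e e0.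
  apply: filterE => y; rewrite expr0 (le_trans (rseq_mdist_le1 _ _))// lerDl ltW//.
have h1 : \forall y \near F, `|atan (x 0%N) - atan (y 0%N)| < e.
  have : (fun y : rseq R => atan (y 0%N)) @ F --> atan (x 0%N).
    by apply: (cvg_comp _ _ (Fx 0%N)); exact: continuous_atan.
  by move=> /cvgr_dist_lt/(_ _ e0).
have h2 : \forall y \near F, mdist (Defs.shift x) (Defs.shift y) <= 2^-1 ^+ n + e.
  apply: (IH (Defs.shift x) (@Defs.shift R @ F)) => // i.
  exact: (Fx i.+1).
near=> y.
rewrite rseq_mdist_recl exprS.
have a1 : `|atan (x 0%N) - atan (y 0%N)| < e by near: y.
have a2 : mdist (Defs.shift x) (Defs.shift y) <= 2^-1 ^+ n + e by near: y.
have : (pi * 2)^-1 * `|atan (x 0%N) - atan (y 0%N)| <= 2^-1 * e.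
  have h := @pi_ge2 R; rewrite ler_pM ?invr_ge0 ?mulr_ge0 ?pi_ge0//; last exact: ltW.
  by rewrite lef_pV2 ?posrE ?mulr_gt0 ?pi_gt0//; lra.
lra.
Unshelve. all: by end_near. Qed.

End rseq_metric_theory.

Section continuity.
Context {R : realType}.

Lemma bounded_continuousP (T : topologicalType) (g : T -> R) :
  bounded_continuous g <->
  continuous g /\ exists M : R, forall x, `|g x| <= M.
Proof.
split=> -[cg [M gM]]; split => //.
  by case: gM => _ /(_ (M + 1)) gM; exists (M + 1) => x; apply: gM; rewrite ?ltrDl.
exists M; split; first exact: num_real.
by move=> N MN x _ /=; rewrite (le_trans (gM x))// ltW.
Qed.

Lemma near_mdist (x : rseq R) (e : R) : 0 < e -> \forall y \near x, mdist x y < e.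
Proof.
move=> e0; have := @nbhsx_ballx _ _ x _ e0.
by rewrite ballEmdist.
Qed.

Lemma continuous_prepend (x : rseq R) :
  continuous (fun a : R => prepend a x : rseq R).
Proof.
move=> a; apply: cvg_rseq => -[|i]; first exact: cvg_id.
by have : (fun=> x i) @ a --> x i by exact: cvg_cst.
Qed.

Lemma continuous_rseq_shift : continuous (@Defs.shift R).
Proof.
move=> x; apply/(@metricType_numDomainType.cvgrPdist_lt _ _ _ (nbhs x)) => e e0.
have : \forall y \near x, mdist x y < e / 2.
  by apply: near_mdist; rewrite divr_gt0.
apply: filterS => y; have := rseq_mdist_shift x y; lra.
Qed.

End continuity.

(** * Hölder functions *)

Section holder_theory.
Context {R : realType} (alpha : R) (halpha : 0 < alpha <= 1).
Implicit Types (x y z : rseq R) (g h : rseq R -> R).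

Definition hdist x y : R := mdist x y `^ alpha.
Definition theta : R := 2^-1 `^ alpha.

Let alpha_gt0 : 0 < alpha. Proof. by case/andP: halpha. Qed.
Let alpha_le1 : alpha <= 1. Proof. by case/andP: halpha. Qed.

Lemma hdist_ge0 x y : 0 <= hdist x y. Proof. exact: powR_ge0. Qed.

Lemma hdist_le1 x y : hdist x y <= 1.
Proof.
have -> : 1 = 1 `^ alpha :> R by rewrite powR1.
rewrite /hdist ge0_ler_powR ?nnegrE ?mdist_ge0 ?(ltW alpha_gt0)//.
exact: rseq_mdist_le1.
Qed.

Lemma ler_mdist_hdist x y : mdist x y <= hdist x y.
Proof.
have := mdist_ge0 x y; rewrite le_eqVlt => /predU1P[<-|d0].
  exact: powR_ge0.
by apply: ger1_powR; rewrite ?alpha_le1 // d0 rseq_mdist_le1.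
Qed.

Lemma theta_gt0 : 0 < theta. Proof. by rewrite powR_gt0. Qed.

Lemma theta_lt1 : theta < 1.
Proof.
rewrite /theta /powR ifF ?gt_eqF// expR_lt1 pmulr_rlt0//.
by rewrite ln_lt0// invr_gt0 ltr0n invf_lt1// ltr1n.
Qed.

Lemma hdist_prepend a x y :
  hdist (prepend a x) (prepend a y) = theta * hdist x y.
Proof. by rewrite /hdist rseq_mdist_prependr powRM// mdist_ge0. Qed.

Lemma hdist_shift x y :
  hdist (Defs.shift x) (Defs.shift y) <= 2 `^ alpha * hdist x y.
Proof.
rewrite -powRM ?mdist_ge0// /hdist ge0_ler_powR ?nnegrE ?(ltW alpha_gt0)//.
- exact: mdist_ge0.
- by rewrite mulr_ge0// mdist_ge0.
- exact: rseq_mdist_shift.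
Qed.

Lemma holderP g : holder alpha g <->
  exists2 C : R, 0 <= C & forall x y, `|g x - g y| <= C * hdist x y.
Proof.
split=> [[C gC]|[C _ gC]]; last by exists C.
exists (Num.max 0 C); first by rewrite le_max lexx.
move=> x y; apply: le_trans (gC x y) _.
by rewrite ler_wpM2r ?hdist_ge0// le_max lexx orbT.
Qed.

Lemma holder_le K g h : 0 <= K -> holder alpha g ->
  (forall x y, `|h x - h y| <= K * `|g x - g y|) -> holder alpha h.
Proof.
move=> K0 [C gC] hg; exists (K * C) => x y.
by rewrite (le_trans (hg _ _))// -mulrA ler_wpM2l.
Qed.

Lemma holder_cst (c : R) : holder alpha (fun _ : rseq R => c).
Proof. by exists 0 => x y; rewrite subrr normr0 mul0r. Qed.

Lemma holderD g h : holder alpha g -> holder alpha h ->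
  holder alpha (fun x => g x + h x).
Proof.
move=> [C gC] [K hK]; exists (C + K) => x y.
rewrite opprD addrACA mulrDl (le_trans (ler_normD _ _))// lerD//.
Qed.

Lemma holderN g : holder alpha g -> holder alpha (fun x => - g x).
Proof.
by move=> [C gC]; exists C => x y; rewrite -opprD normrN.
Qed.

Lemma holderB g h : holder alpha g -> holder alpha h ->
  holder alpha (fun x => g x - h x).
Proof. by move=> gH hH; apply: holderD => //; exact: holderN. Qed.

Lemma holderZ (k : R) g : holder alpha g -> holder alpha (fun x => k * g x).
Proof.
move=> gH; apply: (@holder_le `|k| g) => // x y.
by rewrite -mulrBr normrM.
Qed.

Lemma holder_sum n (F : nat -> rseq R -> R) :
  (forall i, holder alpha (F i)) -> holder alpha (fun x => \sum_(i < n) F i x).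
Proof.
move=> FH; elim: n => [|n IH].
  rewrite (_ : (fun _ => _) = fun _ => 0); first exact: holder_cst.
  by apply/funext => x; rewrite big_ord0.
rewrite (_ : (fun _ => _) = fun x => \sum_(i < n) F i x + F n x).
  exact: holderD.
by apply/funext => x; rewrite big_ord_recr.
Qed.

Lemma holder_bounded g : holder alpha g -> exists2 M, 0 < M & forall x, `|g x| <= M.
Proof.
move=> /holderP[C C0 gC]; exists (`|g point| + C + 1).
  by rewrite ltr_wpDl// addr_ge0.
move=> x; have := gC x point; have := ler_normD (g point) (g x - g point).
rewrite addrC subrK => h1 h2.
have : C * hdist x point <= C by rewrite ler_piMr// hdist_le1.
lra.
Qed.

Lemma holderM g h : holder alpha g -> holder alpha h ->
  holder alpha (fun x => g x * h x).
Proof.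
move=> gH hH; have [M M0 gM] := holder_bounded gH.
have [N N0 hN] := holder_bounded hH.
case: gH hH => C gC [K hK]; exists (N * C + M * K) => x y.
rewrite (_ : _ - _ = (g x - g y) * h x + g y * (h x - h y)); last by ring.
rewrite (le_trans (ler_normD _ _))// !normrM mulrDl lerD//.
  by rewrite mulrC -mulrA ler_pM.
by rewrite -mulrA ler_pM.
Qed.

Lemma ler_norm_expR (M a b : R) : `|a| <= M -> `|b| <= M ->
  `|expR a - expR b| <= expR M * `|a - b|.
Proof.
wlog ab : a b / b <= a.
  move=> H aM bM; have [ba|/ltW ab] := leP b a; first exact: H.
  by rewrite distrC (distrC a); exact: H.
move=> aM bM; rewrite !ger0_norm ?subr_ge0 ?ler_expR//.
have : expR a * (1 + (b - a)) <= expR a * expR (b - a).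
  by rewrite ler_wpM2l ?expR_ge0 ?expR_ge1Dx.
rewrite -expRD subrKC => h.
have : expR a * (a - b) <= expR M * (a - b).
  by rewrite ler_wpM2r ?subr_ge0// ler_expR (le_trans (ler_norm _)).
lra.
Qed.

Lemma holder_expR g : holder alpha g -> holder alpha (fun x => expR (g x)).
Proof.
move=> gH; have [M M0 gM] := holder_bounded gH.
by apply: (@holder_le (expR M) g) => [|//|x y]; rewrite ?expR_ge0// ler_norm_expR.
Qed.

Lemma holderV (m : R) g : 0 < m -> (forall x, m <= g x) -> holder alpha g ->
  holder alpha (fun x => (g x)^-1).
Proof.
move=> m0 mg gH; apply: (@holder_le (m^-1 * m^-1) g) => [|//|x y].
  by rewrite mulr_ge0// invr_ge0 ltW.
have gx : 0 < g x by rewrite (lt_le_trans m0).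
have gy : 0 < g y by rewrite (lt_le_trans m0).
rewrite (_ : _ - _ = (g x)^-1 * (g y)^-1 * (g y - g x)); last first.
  by field; rewrite !gt_eqF.
rewrite normrM distrC ler_wpM2r// ger0_norm ?mulr_ge0 ?invr_ge0 ?(ltW gx) ?(ltW gy)//.
by rewrite ler_pM ?invr_ge0 ?(ltW gx) ?(ltW gy)// lef_pV2 ?posrE.
Qed.

Lemma holder_minc (k : R) g : holder alpha g ->
  holder alpha (fun x => Num.min (g x) k).
Proof.
move=> gH; apply: (@holder_le 1 g) => // x y; rewrite mul1r.
case: (leP (g x) k) => xk; case: (leP (g y) k) => yk; rewrite ler_norml.
- by rewrite -ler_norml.
- by have := ler_norm (g y - g x); rewrite distrC => ?; apply/andP; split; lra.
- by have := ler_norm (g x - g y) => ?; apply/andP; split; lra.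
- by rewrite subrr; apply/andP; split => //; rewrite oppr_le0.
Qed.

Lemma holder_lipschitz (K : R) g : 0 <= K ->
  (forall x y, `|g x - g y| <= K * mdist x y) -> holder alpha g.
Proof.
move=> K0 gK; exists K => x y; rewrite (le_trans (gK _ _))// ler_wpM2l//.
exact: ler_mdist_hdist.
Qed.

Lemma holder_shift g : holder alpha g ->
  holder alpha (fun x => g (Defs.shift x)).
Proof.
move=> /holderP[C C0 gC]; exists (C * 2 `^ alpha) => x y.
by rewrite (le_trans (gC _ _))// -mulrA ler_wpM2l// hdist_shift.
Qed.

(** A coordinate is unbounded, hence not Hölder; a function of it becomes Hölder when it is
    Lipschitz in the arctangent. *)
Lemma holder_coord (K : R) (h : R -> R) i : 0 <= K ->
  (forall a b, `|h a - h b| <= K * `|atan a - atan b|) ->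
  holder alpha (fun x : rseq R => h (x i)).
Proof.
move=> K0 hK; apply: (@holder_lipschitz (K * (pi * 2 ^+ i.+1))) => [|x y].
  by rewrite !mulr_ge0 ?pi_ge0 ?exprn_ge0.
by rewrite (le_trans (hK _ _))// -mulrA ler_wpM2l// norm_atan_coord.
Qed.

Lemma holder_continuous g : holder alpha g -> continuous g.
Proof.
move=> /holderP[C C0 gC] x; apply/(@cvgrPdist_le _ _ _ (nbhs x)) => e e0.
have : \forall y \near x, mdist x y < (e / (C + 1)) `^ alpha^-1.
  by apply: near_mdist; rewrite powR_gt0// divr_gt0// ltr_wpDl.
apply: filterS => y xy; rewrite (le_trans (gC _ _))//.
have : hdist x y <= e / (C + 1).
  rewrite -(powRr1 (_ : 0 <= e / (C + 1))) ?divr_ge0 ?(ltW e0) ?addr_ge0//.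
  have -> : (e / (C + 1)) `^ 1 = (e / (C + 1)) `^ alpha^-1 `^ alpha.
    by rewrite -powRrM mulVf// lt0r_neq0.
  by rewrite /hdist ge0_ler_powR ?nnegrE ?mdist_ge0 ?powR_ge0 ?(ltW alpha_gt0)// ltW.
rewrite ler_pdivlMr ?ltr_wpDl// mulrC; apply: le_trans.
by rewrite ler_wpM2r ?hdist_ge0// lerDl.
Qed.

Lemma holder_bc g : holder alpha g -> bounded_continuous g.
Proof.
move=> gH; apply/bounded_continuousP; split; first exact: holder_continuous.
by have [M _ gM] := holder_bounded gH; exists M.
Qed.

End holder_theory.

(** * The Ruelle operator *)

Lemma Rintegral_dominated_cvg d (T : measurableType d) (R : realType)
    (mu : {measure set T -> \bar R}) (g_ : nat -> T -> R) (g G : T -> R) :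
  (forall n, measurable_fun setT (g_ n)) ->
  (forall x, g_ ^~ x @ \oo --> g x) ->
  mu.-integrable setT (EFin \o G) -> (forall n x, `|g_ n x| <= G x) ->
  \int[mu]_x g_ n x @[n --> \oo] --> \int[mu]_x g x.
Proof.
move=> mg gg iG gG.
have gG' x : `|g x| <= G x.
  have h : `|g_ n x| @[n --> \oo] --> `|g x| by apply: cvg_norm; exact: gg.
  rewrite -(cvg_lim _ h)//; apply: limr_le; first by apply/cvg_ex; eexists; exact: h.
  exact: nearW.
have mg' : measurable_fun setT g.
  apply/measurable_EFinP; apply: (emeasurable_fun_cvg (fun n => EFin \o g_ n)).
    by move=> n; exact/measurable_EFinP.
  by move=> x _; apply/fine_cvgP; split; [exact: nearW|exact: gg].
have ig : mu.-integrable setT (EFin \o g).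
  apply: le_integrable iG => //; first exact/measurable_EFinP.
  by move=> x _ /=; rewrite lee_fin (le_trans (gG' x))// ler_norm.
apply: fine_cvg; rewrite fineK; last exact: integrable_fin_num.
apply: (@dominated_cvg _ _ _ mu setT _ (fun n => EFin \o g_ n) _ (EFin \o G)) => //.
- by move=> n; exact/measurable_EFinP.
- by move=> x _; apply/fine_cvgP; split; [exact: nearW|exact: gg].
- by move=> n x _; rewrite lee_fin.
Qed.

(** * Averages against the probability [f da] *)

Section wint.
Context {R : realType} (f : R -> R).
Hypotheses (hfpos : forall a, 0 < f a) (hfcont : continuous f)
  (hfint : (\int[lebesgue_measure]_a (f a)%:E = 1)%E).
Implicit Types g h : R -> R.

Definition wint g : R := \int[lebesgue_measure]_a (g a * f a).

Let mf : measurable_fun setT f. Proof. exact: continuous_measurable_fun. Qed.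

Let intf : lebesgue_measure.-integrable setT (EFin \o f).
Proof.
apply/integrableP; split; first exact/measurable_EFinP.
under eq_integral do rewrite /= ger0_norm ?(ltW (hfpos _))//.
by rewrite hfint ltry.
Qed.

Lemma bc_integrable_weight g : bounded_continuous g ->
  lebesgue_measure.-integrable setT (EFin \o (fun a => g a * f a)).
Proof.
move=> /bounded_continuousP[cg [M gM]].
have intMf : lebesgue_measure.-integrable setT (EFin \o (fun a => M * f a)).
  exact: (integrableZl measurableT M intf).
apply: le_integrable intMf => //.
  apply/measurable_EFinP; apply: measurable_funM => //.
  exact: continuous_measurable_fun.
move=> a _ /=; rewrite lee_fin !normrM ler_wpM2r//.
by rewrite (le_trans (gM a))// ler_norm.
Qed.

Lemma wintD g h : bounded_continuous g -> bounded_continuous h ->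
  wint (fun a => g a + h a) = wint g + wint h.
Proof.
move=> bg bh; rewrite /wint -RintegralD//; try exact: bc_integrable_weight.
by apply: eq_Rintegral => a _; rewrite mulrDl.
Qed.

Lemma wintZ (k : R) g : bounded_continuous g -> wint (fun a => k * g a) = k * wint g.
Proof.
move=> bg; rewrite /wint -RintegralZl//; last exact: bc_integrable_weight.
by apply: eq_Rintegral => a _; rewrite mulrA.
Qed.

Lemma wint_cst (k : R) : wint (fun=> k) = k.
Proof.
rewrite /wint (@RintegralZl _ _ _ lebesgue_measure setT f k)//.
by rewrite /Rintegral hfint mulr1.
Qed.

Lemma ler_wint g h : bounded_continuous g -> bounded_continuous h ->
  (forall a, g a <= h a) -> wint g <= wint h.
Proof.
move=> bg bh gh; apply: le_Rintegral => //; try exact: bc_integrable_weight.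
by move=> a _; rewrite ler_wpM2r// ltW.
Qed.

Lemma ler_norm_wint g (M : R) : bounded_continuous g -> (forall a, `|g a| <= M) ->
  `|wint g| <= M.
Proof.
move=> bg gM.
have bM k : bounded_continuous (fun _ : R => k).
  by apply/bounded_continuousP; split; [exact: cst_continuous|exists `|k|].
rewrite ler_norml -{1}(wint_cst (- M)) -[X in _ && (_ <= X)](wint_cst M).
by apply/andP; split; apply: ler_wint => // a; have := gM a; rewrite ler_norml => /andP[].
Qed.

Lemma wint_cvg (g_ : nat -> R -> R) g (M : R) :
  (forall n, bounded_continuous (g_ n)) -> (forall n a, `|g_ n a| <= M) ->
  (forall a, g_ ^~ a @ \oo --> g a) -> wint (g_ n) @[n --> \oo] --> wint g.
Proof.
move=> bg gM gg; rewrite /wint.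
apply: (@Rintegral_dominated_cvg _ _ _ (@lebesgue_measure R) (fun n a => g_ n a * f a)
  (fun a => g a * f a) (fun a => M * f a)).
- move=> n; apply: measurable_funM => //; apply: continuous_measurable_fun.
  by case: (bg n).
- by move=> a; apply: cvgM; [exact: gg|exact: cvg_cst].
- exact: (integrableZl measurableT M intf).
- by move=> n a; rewrite normrM (ger0_norm (ltW (hfpos a))) ler_wpM2r// ltW.
Qed.

End wint.

Section bounded_continuous_theory.
Context {R : realType} (T : topologicalType).
Implicit Types g h : T -> R.

Lemma bc_cst (k : R) : bounded_continuous (fun _ : T => k).
Proof.
by apply/bounded_continuousP; split; [exact: cst_continuous|exists `|k|].
Qed.

Lemma bcD g h : bounded_continuous g -> bounded_continuous h ->
  bounded_continuous (fun x => g x + h x).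
Proof.
move=> /bounded_continuousP[cg [M gM]] /bounded_continuousP[ch [N hN]].
apply/bounded_continuousP; split; first by move=> x; apply: cvgD; [exact: cg|exact: ch].
by exists (M + N) => x; rewrite (le_trans (ler_normD _ _))// lerD.
Qed.

Lemma bcM g h : bounded_continuous g -> bounded_continuous h ->
  bounded_continuous (fun x => g x * h x).
Proof.
move=> /bounded_continuousP[cg [M gM]] /bounded_continuousP[ch [N hN]].
apply/bounded_continuousP; split; first by move=> x; apply: cvgM; [exact: cg|exact: ch].
by exists (M * N) => x; rewrite normrM ler_pM.
Qed.

Lemma bcZ (k : R) g : bounded_continuous g -> bounded_continuous (fun x => k * g x).
Proof. by apply: bcM; exact: bc_cst. Qed.

Lemma bcB g h : bounded_continuous g -> bounded_continuous h ->
  bounded_continuous (fun x => g x - h x).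
Proof.
move=> bg bh; under eq_fun do rewrite -mulN1r.
by apply: bcD => //; exact: bcZ.
Qed.

End bounded_continuous_theory.

Section ruelle_operator.
Context {R : realType} (f : R -> R).
Hypotheses (hfpos : forall a, 0 < f a) (hfcont : continuous f)
  (hfint : (\int[lebesgue_measure]_a (f a)%:E = 1)%E).
Context (alpha : R) (halpha : 0 < alpha <= 1).
Context (A : rseq R -> R) (hA : holder alpha A).
Implicit Types (x y : rseq R) (g h : rseq R -> R).

Local Notation L := (ruelle f A).

Lemma ruelleE g x :
  L g x = wint f (fun a => expR (A (prepend a x)) * g (prepend a x)).
Proof. by []. Qed.

Lemma bc_prepend g x : bounded_continuous g ->
  bounded_continuous (fun a : R => g (prepend a x)).
Proof.
move=> /bounded_continuousP[cg [M gM]]; apply/bounded_continuousP; split.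
  move=> a; apply: (@continuous_comp _ _ _ (fun a : R => prepend a x : rseq R) g).
    exact: continuous_prepend.
  exact: cg.
by exists M => a.
Qed.

Lemma bc_ruelle_integrand g x : bounded_continuous g ->
  bounded_continuous (fun a : R => expR (A (prepend a x)) * g (prepend a x)).
Proof.
move=> bg; apply: bcM; last exact: bc_prepend.
apply: (@bc_prepend (fun y => expR (A y))).
by apply: (holder_bc halpha); exact: holder_expR.
Qed.

Lemma ruelleD g h : bounded_continuous g -> bounded_continuous h ->
  L (fun x => g x + h x) = fun x => L g x + L h x.
Proof.
move=> bg bh; apply/funext => x; rewrite !ruelleE.
rewrite -(wintD hfpos hfcont hfint); try exact: bc_ruelle_integrand.
by congr (wint f _); apply/funext => a; rewrite mulrDr.
Qed.

Lemma ruelleZ (k : R) g : bounded_continuous g ->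
  L (fun x => k * g x) = fun x => k * L g x.
Proof.
move=> bg; apply/funext => x; rewrite !ruelleE.
rewrite -(wintZ hfpos hfcont hfint); try exact: bc_ruelle_integrand.
by congr (wint f _); apply/funext => a; rewrite mulrCA.
Qed.

Lemma ruelleB g h : bounded_continuous g -> bounded_continuous h ->
  L (fun x => g x - h x) = fun x => L g x - L h x.
Proof.
move=> bg bh; have -> : (fun x => g x - h x) = (fun x => g x + (-1) * h x).
  by apply/funext => x; rewrite mulN1r.
rewrite ruelleD ?ruelleZ//; last exact: bcZ.
by apply/funext => x; rewrite mulN1r.
Qed.

Lemma ler_ruelle g h : bounded_continuous g -> bounded_continuous h ->
  (forall x, g x <= h x) -> forall x, L g x <= L h x.
Proof.
move=> bg bh gh x; rewrite !ruelleE; apply: (ler_wint hfpos hfcont hfint).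
- exact: bc_ruelle_integrand.
- exact: bc_ruelle_integrand.
- by move=> a; rewrite ler_wpM2l ?expR_ge0.
Qed.

Lemma ruelle_cvg (g_ : nat -> rseq R -> R) g (M : R) :
  (forall n, bounded_continuous (g_ n)) -> (forall n x, `|g_ n x| <= M) ->
  (forall x, g_ ^~ x @ \oo --> g x) -> forall x, L (g_ n) x @[n --> \oo] --> L g x.
Proof.
move=> bg gM gg x; have [MA MA0 AM] := holder_bounded halpha hA.
apply: (@wint_cvg _ _ hfpos hfcont hfint
  (fun n a => expR (A (prepend a x)) * g_ n (prepend a x)) _ (expR MA * M)).
- by move=> n; exact: bc_ruelle_integrand.
- move=> n a; rewrite normrM ler_pM// ger0_norm ?expR_ge0// ler_expR.
  by rewrite (le_trans _ (AM (prepend a x)))// ler_norm.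
- by move=> a; apply: cvgM; [exact: cvg_cst|exact: gg].
Qed.

Lemma holder_ruelle g : holder alpha g -> holder alpha (L g).
Proof.
move=> gH; have /holderP[C C0 hC] := holderM halpha (holder_expR halpha hA) gH.
exists (C * theta alpha) => x y; rewrite !ruelleE.
have bg z := bc_ruelle_integrand z (holder_bc halpha gH).
rewrite -[X in _ - X]mul1r -mulNr -(wintZ hfpos hfcont hfint); last exact: bg.
rewrite -(wintD hfpos hfcont hfint); [|exact: bg|by apply: bcZ; exact: bg].
apply: (ler_norm_wint hfpos hfcont hfint).
  by apply: bcD; [exact: bg|apply: bcZ; exact: bg].
move=> a; rewrite mulN1r (le_trans (hC _ _))// -mulrA ler_wpM2l//.
by rewrite hdist_prepend.
Qed.

Lemma ruelle_cst_ge (m M : R) : 0 <= m -> (forall x, `|A x| <= M) ->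
  forall x, expR (- M) * m <= L (fun=> m) x.
Proof.
move=> m0 AM x; rewrite ruelleE -[leLHS](wint_cst hfpos hfcont hfint).
apply: (ler_wint hfpos hfcont hfint).
- exact: bc_cst.
- by apply: bc_ruelle_integrand; exact: bc_cst.
- move=> a; rewrite ler_wpM2r// ler_expR.
  by have := AM (prepend a x); rewrite ler_norml => /andP[].
Qed.

Lemma ler_norm_ruelle (M N : R) g : bounded_continuous g ->
  (forall x, `|A x| <= M) -> (forall x, `|g x| <= N) ->
  forall x, `|L g x| <= expR M * N.
Proof.
move=> bg AM gN x; apply: (ler_norm_wint hfpos hfcont hfint).
  exact: bc_ruelle_integrand.
move=> a; rewrite normrM ler_pM// ger0_norm ?expR_ge0// ler_expR.
by rewrite (le_trans _ (AM (prepend a x)))// ler_norm.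
Qed.

Lemma holder_iter_ruelle n g : holder alpha g -> holder alpha (iter n L g).
Proof. by move=> gH; elim: n => //= n; exact: holder_ruelle. Qed.

End ruelle_operator.

(** * Cone contraction and the eigenfunction *)

Section geometric_cauchy.
Context {R : realType}.

Lemma geo_small (K r e : R) : 0 <= r < 1 -> 0 < e -> exists n, K * r ^+ n < e.
Proof.
move=> /andP[r0 r1] e0.
have : K * r ^+ n @[n --> \oo] --> K * 0.
  by apply: cvgM; [exact: cvg_cst|apply: cvg_expr; rewrite ger0_norm].
rewrite mulr0 => /cvgr_lt/(_ _ e0)[n _ /(_ n (leqnn n)) ?].
by exists n.
Qed.

Lemma geo_cauchy (u : nat -> R) (K r : R) : 0 <= r < 1 ->
  (forall n k, `|u (n + k)%N - u n| <= K * r ^+ n) ->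
  cvgn u /\ forall n, `|limn u - u n| <= K * r ^+ n.
Proof.
move=> r01 uK.
have cu : cvgn u.
  apply: cauchy_cvg; apply: cauchy_exP => e e0.
  have [n ne] := geo_small K r01 e0; exists (u n), n => // m /= nm.
  by rewrite /ball/= distrC -(subnKC nm) (le_lt_trans (uK _ _)).
split=> // n.
have h : `|u k - u n| @[k --> \oo] --> `|limn u - u n|.
  by apply: cvg_norm; apply: cvgB => //; exact: cvg_cst.
rewrite -(cvg_lim _ h)//; apply: limr_le; first by apply/cvg_ex; eexists; exact: h.
by exists n => // k /= nk; rewrite -(subnKC nk).
Qed.

Lemma sum_half_pow_le (e : R) n : 0 <= e -> \sum_(i < n) e / 2 ^+ i.+1 <= e.
Proof.
move=> e0; suff -> : \sum_(i < n) e / 2 ^+ i.+1 = e * (1 - (2 ^+ n)^-1).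
  by rewrite ler_piMr// lerBlDr lerDl invr_ge0 exprn_ge0.
elim: n => [|n IH]; first by rewrite big_ord0 expr0 invr1 subrr mulr0.
by rewrite big_ord_recr/= IH exprS invfM; field; rewrite expf_neq0.
Qed.

Lemma expR_sub1_le (z : R) : expR z - 1 <= z * expR z.
Proof.
have : (1 - z) * expR z <= expR (- z) * expR z.
  by rewrite ler_wpM2r ?expR_ge0// expR_ge1Dx.
by rewrite -expRD addNr expR0; lra.
Qed.

End geometric_cauchy.

Section cone.
Context {R : realType} (f : R -> R).
Hypotheses (hfpos : forall a, 0 < f a) (hfcont : continuous f)
  (hfint : (\int[lebesgue_measure]_a (f a)%:E = 1)%E).
Context (alpha : R) (halpha : 0 < alpha <= 1).
Implicit Types (x y : rseq R) (g h u v w : rseq R -> R).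

Local Notation D := (hdist alpha).

(** The condition is that [ln u] be Hölder with constant [B]. Written multiplicatively it is linear
    in [u], so it passes to integrals and pointwise limits. *)
Definition cone (B : R) u :=
  (forall x, 0 < u x) /\ forall x y, u x <= expR (B * D x y) * u y.

Lemma cone_le B u : 0 <= B -> cone B u -> forall x y, u x <= expR B * u y.
Proof.
move=> B0 [u0 uB] x y; rewrite (le_trans (uB x y))// ler_wpM2r ?(ltW (u0 y))//.
by rewrite ler_expR ler_piMr// hdist_le1.
Qed.

Lemma cone_weaken B B' u : B' <= B -> cone B' u -> cone B u.
Proof.
move=> BB [u0 uB]; split=> // x y; rewrite (le_trans (uB x y))// ler_wpM2r ?(ltW (u0 y))//.
by rewrite ler_expR ler_wpM2r// hdist_ge0.
Qed.

Lemma cone_cst (B c : R) : 0 <= B -> 0 < c -> cone B (fun=> c).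
Proof.
move=> B0 c0; split=> // x y; rewrite ler_peMl ?(ltW c0)//.
by rewrite -expR0 ler_expR mulr_ge0 ?hdist_ge0.
Qed.

Lemma coneZ (B c : R) u : 0 < c -> cone B u -> cone B (fun x => c * u x).
Proof.
move=> c0 [u0 uB]; split=> [x|x y]; first by rewrite mulr_gt0.
by rewrite mulrCA ler_pM2l.
Qed.

Lemma cone_holder B u : 0 <= B -> cone B u -> holder alpha u.
Proof.
move=> B0 uB; pose M := expR B * u point.
have uM y : u y <= M by exact: cone_le.
have [u0 uD] := uB.
have key x y : u x - u y <= B * expR B * M * D x y.
  have D0 := hdist_ge0 alpha x y; have D1 := hdist_le1 halpha x y.
  rewrite (@le_trans _ _ ((expR (B * D x y) - 1) * u y))//.
    by have := uD x y; lra.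
  rewrite (@le_trans _ _ (B * D x y * expR (B * D x y) * u y))//.
    by rewrite ler_wpM2r ?(ltW (u0 y))// expR_sub1_le.
  rewrite (_ : B * expR B * M * D x y = B * D x y * expR B * M); last by ring.
  rewrite ler_pM ?(ltW (u0 y)) ?mulr_ge0 ?expR_ge0// ler_wpM2l ?mulr_ge0//.
  by rewrite ler_expR ler_piMr.
exists (B * expR B * M) => x y; rewrite ler_norml key andbT.
have := key y x; rewrite /hdist metric_sym; lra.
Qed.

Context (A : rseq R -> R) (hA : holder alpha A).
Local Notation L := (ruelle f A).
Local Notation th := (theta alpha).

(** Compare the integrands at [prepend a x] and [prepend a y] for the same [a]: their [hdist] is
    [th * D x y], the weight [expR A] costs [CA] and [u] costs [B]. *)
Lemma cone_ruelle (CA B : R) u : 0 <= B ->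
  (forall x y, `|A x - A y| <= CA * D x y) ->
  cone B u -> cone (th * (CA + B)) (L u).
Proof.
move=> B0 AC uB; have uH := cone_holder B0 uB.
have bu := holder_bc halpha uH; have [u0 uD] := uB.
split=> [x|x y].
  have [M M0 AM] := holder_bounded halpha hA.
  (* Positivity: Harnack bounds [u] below by a positive constant, whose image is bounded below
     because [A] is bounded. *)
  have m0 : 0 < expR (- B) * u point by rewrite mulr_gt0 ?expR_gt0.
  apply: (@lt_le_trans _ _ (L (fun=> expR (- B) * u point) x)).
    apply: (lt_le_trans _ (ruelle_cst_ge hfpos hfcont hfint halpha hA (ltW m0) AM x)).
    by rewrite mulr_gt0 ?expR_gt0.
  apply: (ler_ruelle hfpos hfcont hfint halpha hA) => //; first exact: bc_cst.
  move=> y; rewrite expRN mulrC ler_pdivrMr ?expR_gt0// mulrC.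
  exact: cone_le.
rewrite !ruelleE -(wintZ hfpos hfcont hfint); last exact: (bc_ruelle_integrand halpha hA).
apply: (ler_wint hfpos hfcont hfint).
- exact: (bc_ruelle_integrand halpha hA).
- by apply: bcZ; exact: (bc_ruelle_integrand halpha hA).
move=> a; have := uD (prepend a x) (prepend a y).
have := AC (prepend a x) (prepend a y); rewrite hdist_prepend => h1 h2.
apply: le_trans (ler_wpM2l (expR_ge0 _) h2) _.
rewrite !mulrA ler_wpM2r ?(ltW (u0 _))// -!expRD ler_expR.
have := le_trans (ler_norm _) h1; lra.
Qed.

Variables (CA : R).
Hypotheses (CA0 : 0 <= CA) (AC : forall x y, `|A x - A y| <= CA * D x y).

(* The solution [B] of [th * (CA + B) = B - th]: the cone of exponent [B] is
   mapped into the smaller cone of exponent [B - th], see [cone_ruelle']. *)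
Definition cone_expo : R := (CA + 1) * th / (1 - th).
Local Notation B := cone_expo.
Local Notation B' := (cone_expo - th).

Lemma cone_expoE : th * (CA + B) = B'.
Proof.
rewrite /cone_expo; field.
by rewrite subr_eq0 gt_eqF// theta_lt1.
Qed.

Lemma cone_expo'_ge0 : 0 <= B'.
Proof.
rewrite -cone_expoE mulr_ge0 ?(ltW (theta_gt0 _))// addr_ge0//.
by rewrite !mulr_ge0 ?invr_ge0 ?subr_ge0 ?addr_ge0 ?(ltW (theta_gt0 _)) ?(ltW (theta_lt1 halpha)).
Qed.

Lemma cone_expo_ge0 : 0 <= B.
Proof. have := cone_expo'_ge0; have := theta_gt0 alpha; lra. Qed.

Lemma cone_ruelle' u : cone B u -> cone B' (L u).
Proof. by rewrite -cone_expoE; apply: cone_ruelle => //; exact: cone_expo_ge0. Qed.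

Lemma cone'_cone u : cone B' u -> cone B u.
Proof. by apply: cone_weaken; have := theta_gt0 alpha; lra. Qed.

Lemma cone_iter n u : cone B u -> cone B (iter n L u).
Proof. by move=> uB; elim: n => //= n IH; apply: cone'_cone; exact: cone_ruelle'. Qed.

(** For a distance [d], [th * d] is below [expR (B * d) - expR (B' * d)], and the denominator times
    [d] is above [expR (B * d) - expR (- (B' * d))]. The extra 1 gives [kappa < 1], as [th < 1]. *)
Definition kappa : R := th / ((B + B') * expR (B + B') + 1).

Lemma kappa01 : 0 < kappa < 1.
Proof.
have := cone_expo'_ge0; have := cone_expo_ge0 => b b'.
have h : 0 <= (B + B') * expR (B + B') by exact: mulr_ge0 (addr_ge0 b b') (expR_ge0 _).
rewrite /kappa divr_gt0 ?theta_gt0 ?ltr_wpDl//= ltr_pdivrMr ?ltr_wpDl// mul1r.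
have := theta_lt1 halpha; lra.
Qed.

(* Elements of the smaller cone are interior to the larger one: a definite
   proportion of [w] can be subtracted from [u]. This is the source of the
   contraction and replaces the Hilbert metric. *)
Lemma cone_sub u w (t : R) : cone B' u -> cone B' w -> 0 <= t ->
  (forall y, t * w y <= kappa * u y) -> cone B (fun x => u x - t * w x).
Proof.
move=> [u0 uD] [w0 wD] t0 tk; have /andP[k0 k1] := kappa01.
split=> [x|x y].
  rewrite subr_gt0 (le_lt_trans (tk x))// gtr_pMl//.
have D0 := hdist_ge0 alpha x y; have D1 := hdist_le1 halpha x y.
have b0 := cone_expo_ge0; have b'0 := cone_expo'_ge0; have bb0 := addr_ge0 b0 b'0.
set d := D x y in D0 D1 *; have thp := theta_gt0 alpha.
(* The cone inequality for the difference reads [t * (expR (B * d) * w y - w x) <= expR (B * d) * u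
   y - u x]. The smaller cone bounds [w x] below and [u x] above; [kappa] compares the two
   exponential gaps that result. *)
have wx : expR (- (B' * d)) * w y <= w x.
  rewrite expRN mulrC ler_pdivrMr ?expR_gt0// mulrC.
  by have := wD y x; rewrite /hdist metric_sym.
have ux := uD x y; rewrite -/d in ux.
have e1 : th * d <= expR (B * d) - expR (B' * d).
  have -> : B * d = B' * d + th * d by ring.
  rewrite expRD -{2}(mulr1 (expR _)) -mulrBr.
  rewrite -[leLHS]mul1r ler_pM ?mulr_ge0 ?(ltW thp)//.
    by rewrite -expR0 ler_expR mulr_ge0.
  have := expR_ge1Dx (th * d); lra.
have e2 : expR (B * d) - expR (- (B' * d)) <= ((B + B') * expR (B + B') + 1) * d.
  have -> : B * d = - (B' * d) + (B + B') * d by ring.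
  rewrite [expR (- _ + _)]expRD -{2}(mulr1 (expR (- _))) -mulrBr.
  have bb := mulr_ge0 bb0 D0.
  rewrite (@le_trans _ _ (1 * ((B + B') * d * expR ((B + B') * d))))//.
    rewrite ler_pM ?expR_ge0 ?expR_sub1_le//.
      by rewrite subr_ge0 -expR0 ler_expR.
    by rewrite -expR0 ler_expR oppr_le0 mulr_ge0.
  have -> : ((B + B') * expR (B + B') + 1) * d = (B + B') * d * expR (B + B') + d by ring.
  rewrite mul1r ler_wpDr// ler_wpM2l//.
  by rewrite ler_expR ler_piMr.
have e3 : kappa * (expR (B * d) - expR (- (B' * d))) <= expR (B * d) - expR (B' * d).
  apply: le_trans e1; apply: le_trans (ler_wpM2l (ltW k0) e2) _.
  rewrite /kappa mulrA divfK//.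
  by rewrite gt_eqF// ltr_wpDl// mulr_ge0 ?expR_ge0.
have e4 : t * (expR (B * d) * w y - w x) <= t * w y * (expR (B * d) - expR (- (B' * d))).
  rewrite -mulrA ler_wpM2l//; move: wx; lra.
have e5 : t * w y * (expR (B * d) - expR (- (B' * d))) <=
    u y * (expR (B * d) - expR (B' * d)).
  apply: (@le_trans _ _ (kappa * u y * (expR (B * d) - expR (- (B' * d))))).
    rewrite ler_wpM2r// subr_ge0 ler_expR (@le_trans _ _ 0)// ?oppr_le0 mulr_ge0//.
  by rewrite (mulrC kappa) -mulrA ler_wpM2l// ltW.
move: ux e4 e5; lra.
Qed.

(** Four factors [expR B'] are lost in [cone_sub_step]: two to keep the subtracted multiple of [L w]
    below [kappa * L v], two more to bound that multiple from below by a share of [L v]. *)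
Definition rate : R := 1 - kappa * expR (- (4 * B')).

Lemma rate01 : 0 <= rate < 1.
Proof.
have /andP[k0 k1] := kappa01; have := cone_expo'_ge0 => b'.
have e1 : expR (- (4 * B')) <= 1 by rewrite -expR0 ler_expR oppr_le0 mulr_ge0.
have e0 := expR_gt0 (- (4 * B')).
have h : 0 < kappa * expR (- (4 * B')) by rewrite mulr_gt0.
have : kappa * expR (- (4 * B')) <= kappa by rewrite ler_piMr// ltW.
by rewrite /rate => ?; apply/andP; split; lra.
Qed.

Lemma ler_iter_ruelle n u w : holder alpha u -> holder alpha w ->
  (forall x, u x <= w x) -> forall x, iter n L u x <= iter n L w x.
Proof.
move=> uH wH uw; elim: n => //= n IH x.
by apply: (ler_ruelle hfpos hfcont hfint halpha hA) => //;
  apply: (holder_bc halpha); exact: holder_iter_ruelle.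
Qed.

Lemma iter_ruelleZ n (c : R) u : holder alpha u ->
  iter n L (fun x => c * u x) = fun x => c * iter n L u x.
Proof.
move=> uH; elim: n => //= n ->; rewrite (ruelleZ hfpos hfcont hfint halpha hA)//.
by apply: (holder_bc halpha); exact: holder_iter_ruelle.
Qed.

Lemma cone_sub_step v w : cone B v -> cone B w -> exists t, [/\ 0 <= t,
  cone B (fun x => L v x - t * L w x) &
  forall x, L v x - t * L w x <= rate * L v x].
Proof.
move=> vB wB; have v'B := cone_ruelle' vB; have w'B := cone_ruelle' wB.
have b'0 := cone_expo'_ge0; have /andP[k0 k1] := kappa01.
have [v0 _] := v'B; have [w0 _] := w'B.
have vle := cone_le b'0 v'B; have wle := cone_le b'0 w'B.
set E := expR B' in vle wle.
have E0 : 0 < E by exact: expR_gt0.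
(* The ratio [L v / L w] is taken at the base point; [E ^- 2] pays for moving both functions to an
   arbitrary point. *)
pose t := kappa * E ^- 2 * (L v point / L w point).
have t0 : 0 <= t.
  apply: mulr_ge0; first by rewrite mulr_ge0 ?(ltW k0)// invr_ge0 exprn_ge0 ?(ltW E0).
  by rewrite divr_ge0 ?(ltW (v0 _)) ?(ltW (w0 _)).
have tw y : t * L w y = kappa * (L v point * L w y / (E ^+ 2 * L w point)).
  by rewrite /t; field; rewrite !gt_eqF.
exists t; split => //.
  apply: cone_sub => // y; rewrite tw ler_wpM2l ?(ltW k0)//.
  rewrite ler_pdivrMr ?mulr_gt0 ?exprn_gt0//.
  rewrite (_ : _ * (_ * _) = (E * L v y) * (E * L w point)); last by ring.
  by rewrite ler_pM ?(ltW (v0 _)) ?(ltW (w0 _)).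
move=> y; rewrite /rate mulrBl mul1r lerB// tw -(mulrA kappa) ler_wpM2l ?(ltW k0)//.
rewrite ler_pdivlMr ?mulr_gt0 ?exprn_gt0//.
have -> : expR (- (4 * B')) = E ^- 4 by rewrite expRN expRM_natl.
rewrite (_ : E ^- 4 * L v y * (E ^+ 2 * L w point) = L v y * L w point / E ^+ 2); last first.
  by field; rewrite gt_eqF.
rewrite ler_pdivrMr ?exprn_gt0//.
rewrite (_ : L v point * _ * _ = (E * L v point) * (E * L w y)); last by ring.
by rewrite ler_pM ?(ltW (v0 _)) ?(ltW (w0 _)).
Qed.

(** [iter n L u] splits into [T * iter n L w] and a positive remainder [v] in the cone. After one
    more application of [L], [cone_sub_step] transfers a further share of the remainder to [T] and
    shrinks what is left by the factor [rate]. *)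
Lemma cone_ratio u w (R0 : R) : cone B u -> cone B w ->
  (forall x, u x <= R0 * w x) -> forall n, exists T : R, forall x,
  T * iter n L w x <= iter n L u x <= (T + R0 * rate ^+ n) * iter n L w x.
Proof.
move=> uB wB uw n; have b0 := cone_expo_ge0; have /andP[r0 r1] := rate01.
have wH := cone_holder b0 wB.
suff [T [v [vB vw uE]]] : exists T v, [/\ cone B v,
    forall x, v x <= R0 * rate ^+ n * iter n L w x &
    forall x, iter n L u x = v x + T * iter n L w x].
  exists T => x; rewrite uE mulrDl; have := vw x; have := vB.1 x.
  by move=> ? ?; apply/andP; split; lra.
elim: n => [|n [T [v [vB vw uE]]]].
  exists 0, u; split => // x; last by rewrite mul0r addr0.
  by rewrite expr0 mulr1.
have wnB := cone_iter n wB.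
have [t [t0 v'B v'r]] := cone_sub_step vB wnB.
have bv := holder_bc halpha (cone_holder b0 vB).
have bw := holder_bc halpha (cone_holder b0 wnB).
exists (T + t), (fun x => L v x - t * L (iter n L w) x); split => //= x.
  rewrite (le_trans (v'r x))// exprS mulrCA -mulrA ler_wpM2l//.
  have -> : R0 * rate ^+ n * L (iter n L w) x =
    L (fun x => R0 * rate ^+ n * iter n L w x) x.
    by rewrite (ruelleZ hfpos hfcont hfint halpha hA).
  by apply: (ler_ruelle hfpos hfcont hfint halpha hA) => //; exact: bcZ.
have -> : iter n L u = (fun x => v x + T * iter n L w x) by apply/funext.
rewrite (ruelleD hfpos hfcont hfint halpha hA)//; last exact: bcZ.
by rewrite (ruelleZ hfpos hfcont hfint halpha hA)//; ring.
Qed.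

(* [cone_ratio] applied to [q k] against [1] bounds [q (n + k) - q n] by
   [E ^+ 3 * rate ^+ n] uniformly in [k]. *)
Lemma ruelle_eigenfunction : exists (lam : R) psi, [/\ 0 < lam, cone B psi &
  forall x, L psi x = lam * psi x].
Proof.
have b0 := cone_expo_ge0; have r01 := rate01.
pose v n := iter n L (fun=> 1).
have oneB : cone B (fun=> 1) by apply: cone_cst.
have oneH := holder_cst alpha (1 : R).
have vB n : cone B (v n) by exact: cone_iter.
have vH n := cone_holder b0 (vB n).
have v0 n x : 0 < v n x by case: (vB n).
pose q n x := (v n point)^-1 * v n x.
have qB n : cone B (q n) by apply: coneZ => //; rewrite invr_gt0.
have qH n := cone_holder b0 (qB n).
have q0 n x : 0 < q n x by case: (qB n).
have q1 n : q n point = 1 by rewrite /q mulVf// gt_eqF.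
set E := expR B; have E0 : 0 < E by exact: expR_gt0.
have qE n x : q n x <= E by have := cone_le b0 (qB n) x point; rewrite q1 mulr1.
have qV n x : E^-1 <= q n x.
  rewrite -[leLHS]mul1r ler_pdivrMr// mulrC.
  by have := cone_le b0 (qB n) point x; rewrite q1.
have main x n k : `|q (n + k)%N x - q n x| <= E ^+ 3 * rate ^+ n.
  have qE1 y : q k y <= E * 1 by rewrite mulr1.
  have [T Tb] := cone_ratio (qB k) oneB qE1 n.
  (* [q (n + k)] is [q n * rho] renormalized at [point]. Pinching [rho] in a short interval, with a
     lower bound away from 0, makes [rho x / rho point] close to 1. *)
  pose rho y := iter n L (q k) y / v n y.
  have rhoT y : T <= rho y <= T + E * rate ^+ n.
    by rewrite /rho ler_pdivlMr// ler_pdivrMr//; exact: Tb.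
  have rhoE y : E^-1 <= rho y.
    rewrite /rho ler_pdivlMr// /v.
    have -> : E^-1 * iter n L (fun=> 1) y = iter n L (fun=> E^-1 * 1) y.
      by rewrite iter_ruelleZ.
    apply: ler_iter_ruelle => [||z]; [exact: holder_cst|exact: qH|].
    by rewrite mulr1.
  have rho0 y : 0 < rho y by rewrite (lt_le_trans _ (rhoE y))// invr_gt0.
  have vnk y : v (n + k)%N y = v k point * (rho y * v n y).
    rewrite /rho divfK ?gt_eqF// /q iter_ruelleZ// mulrA divff ?gt_eqF// mul1r.
    by rewrite /v iterD.
  have -> : q (n + k)%N x - q n x = q n x * ((rho x - rho point) / rho point).
    by rewrite /q !vnk; field; rewrite !gt_eqF.
  (* One factor [E] each for [q n x], for the width of the interval containing [rho], and for the
     inverse of [rho point]. *)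
  rewrite normrM (ger0_norm (ltW (q0 _ _))) normrM (gtr0_norm (_ : 0 < (rho point)^-1)).
    rewrite exprS -mulrA ler_pM ?(ltW (q0 _ _)) ?mulr_ge0 ?invr_ge0 ?(ltW (rho0 _))//.
    rewrite exprS expr1 -mulrA [leRHS]mulrC.
    rewrite ler_pM ?invr_ge0 ?(ltW (rho0 _))//.
      have := rhoT x; have := rhoT point.
      by move=> /andP[? ?] /andP[? ?]; rewrite ler_norml; apply/andP; split; lra.
    by rewrite -(invrK E) lef_pV2 ?posrE ?invr_gt0.
  by rewrite invr_gt0.
pose psi x := limn (fun n => q n x).
have qcvg x : (fun n => q n x) @ \oo --> psi x.
  by have [] := geo_cauchy r01 (main x).
have psiB : cone B psi.
  split=> [x|x y].
    rewrite (@lt_le_trans _ _ E^-1) ?invr_gt0//.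
    by apply: limr_ge; [apply/cvg_ex; eexists; exact: qcvg|exact: nearW].
  apply: (ler_cvg_to (qcvg x)
    (_ : (fun n => expR (B * D x y) * q n y) @ \oo --> expR (B * D x y) * psi y)).
  - by apply: cvgM; [exact: cvg_cst|exact: qcvg].
  - by apply: nearW => n; case: (qB n).
have Lq x : L (q n) x @[n --> \oo] --> L psi x.
  apply: (ruelle_cvg hfpos hfcont hfint halpha hA (M := E)).
  - by move=> n; apply: (holder_bc halpha); exact: qH.
  - by move=> n y; rewrite ger0_norm ?(ltW (q0 _ _)).
  - exact: qcvg.
(* Every [q n] is 1 at [point], hence so is [psi], and the eigenvalue can only be [L psi point]. *)
exists (L psi point), psi; split => //.
  by have [] := cone_ruelle' psiB.
move=> x.
have LqE n y : L (q n) y = L (q n) point * q n.+1 y.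
  rewrite /q (ruelleZ hfpos hfcont hfint halpha hA); last exact: (holder_bc halpha).
  have := v0 n.+1 point; rewrite -[v n.+1]/(L (v n)) => ?.
  by field; rewrite !gt_eqF.
have h : L (q n) point * q n.+1 x @[n --> \oo] --> L psi point * psi x.
  apply: cvgM; first exact: Lq.
  by rewrite (cvg_shiftS (fun n => q n x)); exact: qcvg.
rewrite -(cvg_lim _ (Lq x))//; apply/cvg_lim => //.
rewrite (_ : (fun n => L (q n) x) = (fun n => L (q n) point * q n.+1 x))//.
by apply/funext => n; exact: LqE.
Qed.

End cone.

(** * The normalized operator *)

Section ruelle_iterates.
Context {R : realType} (f : R -> R).
Hypotheses (hfpos : forall a, 0 < f a) (hfcont : continuous f)
  (hfint : (\int[lebesgue_measure]_a (f a)%:E = 1)%E).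
Context (alpha : R) (halpha : 0 < alpha <= 1).
Context (A : rseq R -> R) (hA : holder alpha A).
Local Notation L := (ruelle f A).
Implicit Types (x y : rseq R) (g h u v w : rseq R -> R).

Lemma holder_ln (m : R) g : 0 < m -> (forall x, m <= g x) -> holder alpha g ->
  holder alpha (fun x => ln (g x)).
Proof.
move=> m0 mg gH; apply: (@holder_le _ alpha m^-1 g) => [|//|x y].
  by rewrite invr_ge0 ltW.
have key a b : m <= b -> b <= a -> `|ln a - ln b| <= m^-1 * `|a - b|.
  move=> mb ba; have b0 : 0 < b by exact: lt_le_trans mb.
  have a0 : 0 < a by exact: lt_le_trans ba.
  rewrite !ger0_norm ?subr_ge0 ?ler_ln ?posrE//.
  rewrite -ln_div ?posrE//.
  have -> : a / b = 1 + (a - b) / b by field; rewrite gt_eqF.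
  have ab0 : 0 <= (a - b) / b by rewrite divr_ge0 ?subr_ge0// ltW.
  rewrite (le_trans (le_ln1Dx _))//; first by rewrite (lt_le_trans _ ab0)// ltrN10.
  by rewrite mulrC ler_wpM2r ?subr_ge0// lef_pV2 ?posrE.
have [yx|/ltW xy] := leP (g y) (g x); first exact: key.
by rewrite distrC (distrC (g x)); exact: key.
Qed.

Lemma iter_ruelleD n u w : holder alpha u -> holder alpha w ->
  iter n L (fun x => u x + w x) = fun x => iter n L u x + iter n L w x.
Proof.
move=> uH wH; elim: n => //= n ->; rewrite (ruelleD hfpos hfcont hfint halpha hA)//;
  by apply: (holder_bc halpha); exact: holder_iter_ruelle.
Qed.

Lemma iter_ruelleB n u w : holder alpha u -> holder alpha w ->
  iter n L (fun x => u x - w x) = fun x => iter n L u x - iter n L w x.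
Proof.
move=> uH wH; elim: n => //= n ->; rewrite (ruelleB hfpos hfcont hfint halpha hA)//;
  by apply: (holder_bc halpha); exact: holder_iter_ruelle.
Qed.

End ruelle_iterates.

Section normalized.
Context {R : realType} (f : R -> R).
Hypotheses (hfpos : forall a, 0 < f a) (hfcont : continuous f)
  (hfint : (\int[lebesgue_measure]_a (f a)%:E = 1)%E).
Context (alpha : R) (halpha : 0 < alpha <= 1).
Context (A : rseq R -> R) (hA : holder alpha A).
Local Notation L := (ruelle f A).
Implicit Types (x y : rseq R) (g h u v w : rseq R -> R).

Context (lam m : R) (psi : rseq R -> R).
Hypotheses (lam0 : 0 < lam) (m0 : 0 < m) (mpsi : forall x, m <= psi x)
  (psiH : holder alpha psi) (psiE : forall x, L psi x = lam * psi x).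
Local Notation P := (ruelle f (normalized_potential A lam psi)).

Let psi0 x : 0 < psi x. Proof. exact: lt_le_trans (mpsi x). Qed.

Lemma holder_normalized : holder alpha (normalized_potential A lam psi).
Proof.
have lH := holder_ln m0 mpsi psiH.
apply: holderB; last exact: holder_cst.
by apply: holderB; [exact: holderD|exact: (holder_shift halpha lH)].
Qed.

Lemma ruelle_normalized g x : bounded_continuous g ->
  P g x = L (fun y => psi y * g y) x / (lam * psi x).
Proof.
move=> bg; rewrite !ruelleE mulrC -(wintZ hfpos hfcont hfint); last first.
  apply: (bc_ruelle_integrand halpha hA (g := fun y => psi y * g y)).
  by apply: bcM => //; exact: (holder_bc halpha).
congr (wint f _); apply/funext => a; rewrite /normalized_potential.
have -> : Defs.shift (prepend a x) = x by [].
rewrite !expRD !expRN !lnK ?posrE//.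
by field; rewrite !gt_eqF.
Qed.

Lemma normalized_cst (c : R) : P (fun=> c) = fun=> c.
Proof.
apply/funext => x; rewrite ruelle_normalized; last exact: bc_cst.
have -> : (fun y => psi y * c) = (fun y => c * psi y) by apply/funext => y; rewrite mulrC.
rewrite (ruelleZ hfpos hfcont hfint halpha hA); last exact: (holder_bc halpha).
by rewrite psiE; field; rewrite !gt_eqF.
Qed.

Lemma iter_normalized n g x : holder alpha g ->
  iter n P g x = iter n L (fun y => psi y * g y) x / (lam ^+ n * psi x).
Proof.
move=> gH; have pgH := holderM halpha psiH gH.
elim: n x => [|n IH] x /=.
  by rewrite expr0 mul1r mulrC mulKf// gt_eqF.
rewrite ruelle_normalized; last first.
  apply: (holder_bc halpha).
  by apply: (holder_iter_ruelle hfpos hfcont hfint halpha holder_normalized).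
have -> : (fun y => psi y * iter n P g y) =
    (fun y => (lam ^+ n)^-1 * iter n L (fun y => psi y * g y) y).
  by apply/funext => y; rewrite IH; field; rewrite !gt_eqF// exprn_gt0.
rewrite (ruelleZ hfpos hfcont hfint halpha hA); last first.
  by apply: (holder_bc halpha); exact: (holder_iter_ruelle hfpos hfcont hfint halpha hA).
by rewrite exprS; field; rewrite !gt_eqF// exprn_gt0.
Qed.

Context (CA : R).
Hypotheses (CA0 : 0 <= CA) (AC : forall x y, `|A x - A y| <= CA * hdist alpha x y).
Local Notation B := (cone_expo alpha CA).
Local Notation rate := (rate alpha CA).
Hypothesis (psiB : cone alpha B psi).

(** With [k = 0] this controls the oscillation of the [n]-th iterate, with [x = y] it makes the
    iterates uniformly Cauchy; together they force a constant limit. *)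
Definition mixing g := exists R0 : R, forall n k x y,
  `|iter (n + k) P g x - iter n P g y| <= R0 * rate ^+ n.

(** Take [w = psi] in [cone_ratio]: its iterates are [lam ^+ n * psi], so the quotient is an iterate
    of [P], pinched between [T] and [T + R0 * rate ^+ n]. Later iterates stay in this interval
    because [P] is monotone and fixes constants. *)
Lemma cone_mixing u : cone alpha B u -> mixing (fun x => u x / psi x).
Proof.
move=> uB; have b0 := cone_expo_ge0 halpha CA0; have uH := cone_holder halpha b0 uB.
have [u0 _] := uB.
pose R0 := expR B ^+ 2 * (u point / psi point).
have uR y : u y <= R0 * psi y.
  have h1 := cone_le halpha b0 uB y point.
  have h2 := cone_le halpha b0 psiB point y.
  rewrite /R0 mulrA mulrAC ler_pdivlMr// (_ : _ ^+ 2 * _ * _ =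
    (expR B * u point) * (expR B * psi y)); last by ring.
  by rewrite ler_pM ?(ltW (u0 _)) ?(ltW (psi0 _)).
have Lpsi n y : iter n L psi y = lam ^+ n * psi y.
  elim: n y => [|n IH] y; first by rewrite expr0 mul1r.
  have -> : iter n.+1 L psi = L (fun y => lam ^+ n * psi y).
    by rewrite iterS; congr (L _); apply/funext.
  rewrite (ruelleZ hfpos hfcont hfint halpha hA); last exact: (holder_bc halpha).
  by rewrite psiE exprSr mulrA.
have gH : holder alpha (fun x => u x / psi x).
  by apply: (holderM halpha) => //; exact: (holderV _ mpsi).
exists R0 => n k x y.
have [T Tb] := cone_ratio hfpos hfcont hfint halpha hA CA0 AC uB psiB uR n.
have PT z : T <= iter n P (fun x => u x / psi x) z <= T + R0 * rate ^+ n.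
  rewrite iter_normalized//.
  have -> : (fun y => psi y * (u y / psi y)) = u.
    by apply/funext => z'; rewrite mulrC divfK// gt_eqF.
  by have := Tb z; rewrite Lpsi ler_pdivlMr ?ler_pdivrMr// mulr_gt0// exprn_gt0.
have PTk z : T <= iter (n + k) P (fun x => u x / psi x) z <= T + R0 * rate ^+ n.
  rewrite addnC iterD; set h := iter n P _ in PT *.
  have hH : holder alpha h.
    exact: (holder_iter_ruelle hfpos hfcont hfint halpha holder_normalized).
  have Pc (c : R) : iter k P (fun=> c) = fun=> c.
    by elim: (k) => //= k' ->; exact: normalized_cst.
  have mono := ler_iter_ruelle hfpos hfcont hfint halpha holder_normalized k.
  apply/andP; split.
    rewrite -[leLHS](congr1 (@^~ z) (Pc T)).
    by apply: mono => // [|z']; [exact: holder_cst|have /andP[] := PT z'].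
  rewrite -[leRHS](congr1 (@^~ z) (Pc (T + R0 * rate ^+ n))).
  by apply: mono => // [|z']; [exact: holder_cst|have /andP[] := PT z'].
have /andP[? ?] := PTk x; have /andP[? ?] := PT y.
by rewrite ler_norml; apply/andP; split; lra.
Qed.

(* A Hölder function times [psi] enters the cone once a large constant is
   added, so [g] is a difference of quotients of cone elements by [psi]. *)
Lemma holder_mixing g : holder alpha g -> mixing g.
Proof.
move=> gH; have hH := holderM halpha psiH gH.
have [M M0 hM] := holder_bounded halpha hH.
have /holderP[C C0 hC] := hH.
have B0 : 0 < B.
  by have := cone_expo'_ge0 halpha CA0; have := theta_gt0 alpha; lra.
(* [M] compensates the negative part of [psi * g], [C / B] makes the variation [C * hdist] at most
   [B * hdist] times the value, and 1 gives strict positivity. *)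
pose t := M + C / B + 1.
have CB : 0 <= C / B by rewrite divr_ge0// ltW.
have t0 : 0 < t by rewrite /t; lra.
have htB : cone alpha B (fun x => psi x * g x + t).
  split=> [x|x y].
    by have := hM x; rewrite ler_norml /t => /andP[? ?]; lra.
  have h1 : C / B <= psi y * g y + t.
    by have := hM y; rewrite ler_norml /t => /andP[? ?]; lra.
  have D0 := hdist_ge0 alpha x y.
  have h2 : psi x * g x - psi y * g y <= C * hdist alpha x y.
    exact: le_trans (ler_norm _) (hC _ _).
  have h3 : C * hdist alpha x y <= B * hdist alpha x y * (psi y * g y + t).
    rewrite (_ : B * hdist alpha x y * _ = (B * (psi y * g y + t)) * hdist alpha x y); last by ring.
    by rewrite ler_wpM2r// mulrC -ler_pdivrMr.
  have h4 : (1 + B * hdist alpha x y) * (psi y * g y + t) <=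
      expR (B * hdist alpha x y) * (psi y * g y + t).
    by rewrite ler_wpM2r ?expR_ge1Dx// (le_trans CB).
  lra.
have tB : cone alpha B (fun=> t) by apply: cone_cst => //; exact: ltW.
have [R1 h1] := cone_mixing htB; have [R2 h2] := cone_mixing tB.
have VH : holder alpha (fun x => (psi x)^-1) by exact: (holderV _ mpsi).
have H1 : holder alpha (fun x => (psi x * g x + t) / psi x).
  by apply: (holderM halpha) => //; apply: holderD => //; exact: holder_cst.
have H2 : holder alpha (fun x => t / psi x) by apply: (holderM halpha) => //; exact: holder_cst.
have -> : g = fun x => (psi x * g x + t) / psi x - t / psi x.
  by apply/funext => x; field; rewrite gt_eqF.
exists (R1 + R2) => n k x y.
rewrite !(iter_ruelleB hfpos hfcont hfint halpha holder_normalized)//.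

rewrite (_ : _ - _ - _ = (iter (n + k) P (fun x => (psi x * g x + t) / psi x) x -
  iter n P (fun x => (psi x * g x + t) / psi x) y) -
  (iter (n + k) P (fun x => t / psi x) x - iter n P (fun x => t / psi x) y)); last by ring.
by rewrite (le_trans (ler_normB _ _))// mulrDl lerD.
Qed.

End normalized.

(** From here on the cones are hidden; they survive as the lower bound [m], the regularity of [psi]
    and the geometric rate [r]. *)
Lemma ruelle_perron_frobenius (R : realType) (f : R -> R)
    (hfpos : forall a, 0 < f a) (hfcont : continuous f)
    (hfint : (\int[lebesgue_measure]_a (f a)%:E = 1)%E)
    (alpha : R) (halpha : 0 < alpha <= 1)
    (A : rseq R -> R) (hA : holder alpha A) :
  exists (lam m r : R) (psi : rseq R -> R),
    [/\ 0 < lam, 0 < m, (forall x, m <= psi x), holder alpha psi &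
        forall x, ruelle f A psi x = lam * psi x] /\
    0 <= r < 1 /\
    forall g, holder alpha g -> exists R0 : R, forall n k x y,
      `|iter (n + k) (ruelle f (normalized_potential A lam psi)) g x -
        iter n (ruelle f (normalized_potential A lam psi)) g y| <= R0 * r ^+ n.
Proof.
have /holderP[CA CA0 AC] := hA.
have [lam [psi [lam0 psiB psiE]]] :=
  ruelle_eigenfunction hfpos hfcont hfint halpha hA CA0 AC.
have b0 := cone_expo_ge0 halpha CA0.
have [psi0 _] := psiB.
pose m := expR (- cone_expo alpha CA) * psi point.
have m0 : 0 < m by rewrite mulr_gt0 ?expR_gt0.
have mpsi x : m <= psi x.
  rewrite /m expRN mulrC ler_pdivrMr ?expR_gt0// mulrC.
  exact: (cone_le halpha b0 psiB).
have psiH := cone_holder halpha b0 psiB.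
exists lam, m, (rate alpha CA), psi; split; first by split.
split; first exact: (rate01 halpha CA0).
by move=> g gH; apply: (holder_mixing hfpos hfcont hfint halpha hA lam0 m0 mpsi psiH psiE CA0 AC psiB gH).
Qed.

(** * Measures on sequences and Daniell's construction *)

Section lipschitz_regularization.
Context {R : realType} (phi : rseq R -> R) (M : R).
Hypothesis phiM : forall x, `|phi x| <= M.

(* The infimal convolution of [phi] with [k * mdist]: a [k]-Lipschitz minorant
   that increases to [phi] at every point of lower semicontinuity. *)
Definition lipreg (k : nat) (x : rseq R) : R :=
  inf [set phi y + k%:R * mdist x y | y in [set: rseq R]].

Let lb k x : has_inf [set phi y + k%:R * mdist x y | y in [set: rseq R]].
Proof.
split; first by exists (phi x + k%:R * mdist x x); exists x.
exists (- M) => _ [y _ <-]; have := phiM y; rewrite ler_norml => /andP[h _].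
by rewrite (le_trans h)// lerDl mulr_ge0// mdist_ge0.
Qed.

Lemma lipreg_le_at k x y : lipreg k x <= phi y + k%:R * mdist x y.
Proof. by apply: ge_inf; [exact: (lb k x).2|exists y]. Qed.

Lemma lipreg_ge k x c : (forall y, c <= phi y + k%:R * mdist x y) -> c <= lipreg k x.
Proof.
move=> h; apply: lb_le_inf; first exact: (lb k x).1.
by move=> _ [y _ <-]; exact: h.
Qed.

Lemma lipreg_le k x : lipreg k x <= phi x.
Proof. by have := lipreg_le_at k x x; rewrite mdistxx mulr0 addr0. Qed.

Lemma lipreg_ge_lb k x c : (forall y, c <= phi y) -> c <= lipreg k x.
Proof.
move=> h; apply: lipreg_ge => y; rewrite (le_trans (h y))//.
by rewrite lerDl mulr_ge0// mdist_ge0.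
Qed.

Lemma lipreg_norm k x : `|lipreg k x| <= M.
Proof.
have h y : - M <= phi y <= M by rewrite -ler_norml.
rewrite ler_norml lipreg_ge_lb/=; last by move=> y; case/andP: (h y).
by rewrite (le_trans (lipreg_le k x))//; case/andP: (h x).
Qed.

Lemma lipreg_nd k l x : (k <= l)%N -> lipreg k x <= lipreg l x.
Proof.
move=> kl; apply: lipreg_ge => y; rewrite (le_trans (lipreg_le_at k x y))//.
by rewrite lerD2l ler_wpM2r ?mdist_ge0// ler_nat.
Qed.

Lemma lipreg_lipschitz k x y : `|lipreg k x - lipreg k y| <= k%:R * mdist x y.
Proof.
have key a b : lipreg k a - lipreg k b <= k%:R * mdist a b.
  rewrite lerBlDr addrC -lerBlDr; apply: lipreg_ge => z.
  rewrite lerBlDr (le_trans (lipreg_le_at k a z))// -addrA lerD2l -mulrDr.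
  by rewrite ler_wpM2l// addrC metric_triangle.
rewrite ler_norml key andbT; have := key y x; rewrite metric_sym; lra.
Qed.

(** Within some distance [d] of [x] one has [c <= phi y]; farther away the penalty is at least
    [k * d], which outweighs [|c| + M] for large [k]. Being one-sided, this also serves for
    indicators of open sets. *)
Lemma lipreg_ge_near x c : (\forall y \near x, c <= phi y) ->
  exists k0, forall k, (k0 <= k)%N -> c <= lipreg k x.
Proof.
move=> /nbhs_ballP[d /= d0 xd].
have [k0 k0d] : exists k0 : nat, `|c| + M <= k0%:R * d.
  exists (Num.trunc ((`|c| + M) / d)).+1.
  by rewrite -ler_pdivrMr// ltW// truncnS_gt.
exists k0 => k k0k; apply: lipreg_ge => y.
have [xy|yx] := ltP (mdist x y) d.
  rewrite (@le_trans _ _ (phi y))//; first by apply: xd; rewrite ballEmdist.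
  by rewrite lerDl mulr_ge0// mdist_ge0.
have := phiM y; rewrite ler_norml => /andP[h _].
have : k0%:R * d <= k%:R * mdist x y by rewrite ler_pM// ?ler_nat// ltW.
have := ler_norm c; lra.
Qed.

Lemma lipreg_cvg x : continuous phi -> lipreg ^~ x @ \oo --> phi x.
Proof.
move=> cphi; apply/cvgrPdist_le => e e0.
have [|k0 h] := @lipreg_ge_near x (phi x - e).
  have /cvgrPdist_le/(_ _ e0) := cphi x; apply: filterS => y.
  by rewrite ler_norml => /andP[_]; lra.
exists k0 => // k /= /h; have := lipreg_le k x => h1 h2.
by rewrite ger0_norm ?subr_ge0//; lra.
Qed.

Lemma holder_lipreg (alpha : R) k : 0 < alpha <= 1 -> holder alpha (lipreg k).
Proof. by move=> halpha; apply: (holder_lipschitz halpha (ler0n R k)); exact: lipreg_lipschitz. Qed.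

End lipschitz_regularization.

Section rseq_measurability.
Context {R : realType}.

Lemma measurable_rseq_open (U : set (rseq R)) : open U -> measurable U.
Proof. by move=> oU; exact: sub_sigma_algebra. Qed.

Lemma continuous_measurable_rseq (g : rseq R -> R) :
  continuous g -> measurable_fun setT g.
Proof.
move=> /continuousP cg; apply: (measurability _ (RGenOpens.measurableE R)).
move=> _ [_ [a [b ->]] <-]; rewrite setTI; apply: measurable_rseq_open.
by apply: cg; exact: interval_open.
Qed.

Lemma measurable_rseq_shift : measurable_fun setT (@Defs.shift R).
Proof.
apply: (@measurability _ _ (rseq R) (rseq R) setT _ (@open (rseq R))) => //.
move=> _ [U oU <-]; rewrite setTI; apply: measurable_rseq_open.
exact: (iffLR (continuousP _) (@continuous_rseq_shift R)) oU.
Qed.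

HB.instance Definition _ := isMeasurableFun.Build _ _ (rseq R) (rseq R)
  (@Defs.shift R) measurable_rseq_shift.

End rseq_measurability.

Section rseq_probability.
Context {R : realType}.
Implicit Types (mu nu : probability (rseq R) R) (g h : rseq R -> R).

Lemma bc_integrable_probability mu g : bounded_continuous g ->
  mu.-integrable setT (EFin \o g).
Proof.
move=> [cg bg]; apply: measurable_bounded_integrable => //.
- by rewrite (le_lt_trans (probability_le1 mu measurableT))// ltry.
- exact: continuous_measurable_rseq.
Qed.

Lemma EFin_Rintegral_bc mu g : bounded_continuous g ->
  (\int[mu]_x (g x)%:E = (\int[mu]_x g x)%:E)%E.
Proof.
by move=> bg; rewrite /Rintegral fineK//; apply: integrable_fin_num => //;
  exact: bc_integrable_probability.
Qed.

Lemma Rintegral_bc_cvg mu (g_ : nat -> rseq R -> R) g (M : R) :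
  (forall n, bounded_continuous (g_ n)) -> (forall n x, `|g_ n x| <= M) ->
  (forall x, g_ ^~ x @ \oo --> g x) ->
  \int[mu]_x g_ n x @[n --> \oo] --> \int[mu]_x g x.
Proof.
move=> bg gM gg; apply: (@Rintegral_dominated_cvg _ _ _ mu g_ g (fun=> M)) => //.
  by move=> n; apply: continuous_measurable_rseq; case: (bg n).
by apply: (bc_integrable_probability mu); exact: bc_cst.
Qed.

Lemma Rintegral_probability_cst mu (c : R) : \int[mu]_x c = c.
Proof.
rewrite Rintegral_cst// (_ : fine _ = 1) ?mulr1//.
exact: (congr1 fine (probability_setT mu)).
Qed.

(** The regularizations of the indicator of an open set increase to it, so both measures agree on
    open sets, which are stable under intersection and generate the Borel sets. *)
Lemma probability_ext_lipreg mu nu :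
  (forall (phi : rseq R -> R) (M : R) k, (forall x, `|phi x| <= M) ->
    \int[mu]_x lipreg phi k x = \int[nu]_x lipreg phi k x) ->
  forall B, measurable B -> mu B = nu B.
Proof.
move=> munu; apply: (@measure_unique _ R (rseq R) (@open (rseq R)) (fun=> setT)) => //.
- by move=> U V; exact: openI.
- by move=> _; exact: openT.
- exact: bigcup_const.
- move=> U oU; pose phi : rseq R -> R := \1_U.
  have phi01 y : 0 <= phi y <= 1.
    by rewrite /phi indicE; case: (y \in U); rewrite ?lexx ?ler01.
  have phiM y : `|phi y| <= 1 by have /andP[? ?] := phi01 y; rewrite ger0_norm.
  have mU := measurable_rseq_open oU.
  have cvg_phi x : lipreg phi ^~ x @ \oo --> phi x.
    have [Ux|Ux] := pselect (U x).
      have [|k0 uk] := @lipreg_ge_near _ _ _ phiM x 1.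
        have := open_nbhs_nbhs (conj oU Ux); apply: filterS => y Uy.
        by rewrite /phi indicE mem_set.
      apply: (@cvg_trans _ (cst (phi x) @ \oo)); last exact: cvg_cst.
      apply: near_eq_cvg; exists k0 => // k /= /uk h.
      have hx : phi x = 1 by rewrite /phi indicE mem_set.
      by apply/eqP; rewrite eq_le (lipreg_le phiM) hx h.
    have -> : lipreg phi ^~ x = cst (phi x); last exact: cvg_cst.
    apply/funext => k /=; apply/eqP; rewrite eq_le (lipreg_le phiM)/=.
    by rewrite {1}/phi indicE memNset//; apply: (lipreg_ge_lb phiM) => y; case/andP: (phi01 y).
  have lim (m : probability (rseq R) R) :
    \int[m]_x lipreg phi k x @[k --> \oo] --> fine (m U).
    have -> : fine (m U) = \int[m]_x phi x.
      by rewrite /Rintegral integral_indic// setIT.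
    apply: (@Rintegral_bc_cvg m (lipreg phi) phi 1) => //.
    - move=> k; apply: (@holder_bc _ 1); first by rewrite ltr01 lexx.
      by apply: (holder_lipreg phiM); rewrite ltr01 lexx.
    - by move=> k x; exact: (lipreg_norm phiM).
  rewrite -[LHS]fineK ?fin_num_measure// -[RHS]fineK ?fin_num_measure//; congr (_%:E).
  rewrite -(cvg_lim _ (lim mu))// -(cvg_lim _ (lim nu))//.
  by congr (limn _); apply/funext => k; exact: munu.
- by move=> _; rewrite (le_lt_trans (probability_le1 mu measurableT))// ltry.
Qed.

Lemma probability_ext mu nu (alpha : R) : 0 < alpha <= 1 ->
  (forall w, holder alpha w -> \int[mu]_x w x = \int[nu]_x w x) ->
  forall B, measurable B -> mu B = nu B.
Proof.
move=> halpha munu; apply: probability_ext_lipreg => phi M k phiM.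
by apply: munu; exact: (holder_lipreg phiM).
Qed.

Lemma Rintegral_distribution_shift mu g : bounded_continuous g ->
  \int[distribution mu (@Defs.shift R)]_x g x = \int[mu]_x g (Defs.shift x).
Proof.
move=> bg; rewrite /Rintegral; congr fine.
rewrite (@integral_distribution _ _ (rseq R) (rseq R) R mu (@Defs.shift R) (EFin \o g))//.
  by apply/measurable_EFinP; apply: continuous_measurable_rseq; case: bg.
have [cg [M gM]] := iffLR (bounded_continuousP g) bg.
apply: (bc_integrable_probability mu (g := g \o @Defs.shift R)); apply/bounded_continuousP; split.
  by move=> x; apply: continuous_comp; [exact: continuous_rseq_shift|exact: cg].
by exists M => x /=.
Qed.

End rseq_probability.

(** * The measure of a positive functional on Hölder functions *)

Section daniell.
Context {R : realType} (alpha : R) (halpha : 0 < alpha <= 1).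
Local Notation T := (rseq R).
Context (l : (T -> R) -> R).
Hypotheses
  (lD : forall g h, holder alpha g -> holder alpha h ->
    l (fun x => g x + h x) = l g + l h)
  (lZ : forall k g, holder alpha g -> l (fun x => k * g x) = k * l g)
  (l0 : forall g, holder alpha g -> (forall x, 0 <= g x) -> 0 <= l g)
  (l1 : l (fun=> 1) = 1).

Lemma functionalB g h : holder alpha g -> holder alpha h -> l (fun x => g x - h x) = l g - l h.
Proof.
move=> gH hH; rewrite -mulN1r -(lZ _ hH) -lD//; last exact: holderZ.
by congr l; apply/funext => x; rewrite mulN1r.
Qed.

Lemma ler_functional g h : holder alpha g -> holder alpha h -> (forall x, g x <= h x) -> l g <= l h.
Proof.
move=> gH hH gh; rewrite -subr_ge0 -functionalB//; apply: l0; first exact: holderB.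
by move=> x; rewrite subr_ge0.
Qed.

Lemma functional_cst0 : l (fun=> 0) = 0.
Proof.
rewrite -[RHS](mul0r (l (fun=> 0))) -lZ; last exact: holder_cst.
by congr l; apply/funext => x; rewrite mul0r.
Qed.

Lemma functional_sum n (F : nat -> T -> R) : (forall i, holder alpha (F i)) ->
  l (fun x => \sum_(i < n) F i x) = \sum_(i < n) l (F i).
Proof.
move=> FH; elim: n => [|n IH].
  by rewrite big_ord0 -[RHS]functional_cst0; congr l; apply/funext => x; rewrite big_ord0.
rewrite big_ord_recr/= -IH -lD//; last exact: holder_sum.
by congr l; apply/funext => x; rewrite big_ord_recr.
Qed.

(* Monotone limits instead of series of functions: a countable union is then
   covered by the diagonal partial sums, so no double series is needed. *)
Definition daniell_cover (E : set T) (s : R) := exists F : nat -> T -> R,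
  [/\ forall k, holder alpha (F k),
      forall k x, 0 <= F k x,
      forall k x, F k x <= F k.+1 x,
      forall x, E x -> exists k, 1 <= F k x &
      forall k, l (F k) <= s].

Definition daniell_inf (E : set T) : R := inf [set s | daniell_cover E s].

Definition daniell_outer (E : set T) : \bar R := (daniell_inf E)%:E.

Lemma le_nondecreasing_fun (F : nat -> T -> R) : (forall k x, F k x <= F k.+1 x) ->
  forall j k x, (j <= k)%N -> F j x <= F k x.
Proof.
move=> nd j k x; move/subnKC => <-; elim: (k - j)%N => [|n IH].
  by rewrite addn0.
by rewrite addnS (le_trans IH).
Qed.

Lemma daniell_cover_ge0 E s : daniell_cover E s -> 0 <= s.
Proof. by move=> [F [FH F0 _ _ Fs]]; rewrite (le_trans _ (Fs 0%N))// l0. Qed.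

Lemma daniell_coverT : daniell_cover setT 1.
Proof.
exists (fun _ _ => 1); split => //; first by move=> _; exact: holder_cst.
- by move=> x _; exists 0%N.
- by move=> _; rewrite l1.
Qed.

Lemma daniell_coverS E E' s : E `<=` E' -> daniell_cover E' s -> daniell_cover E s.
Proof. by move=> EE [F [? ? ? h ?]]; exists F; split => // x /EE/h. Qed.

Lemma has_inf_daniell E : has_inf [set s | daniell_cover E s].
Proof.
split; last by exists 0 => s /daniell_cover_ge0.
by exists 1; exact: daniell_coverS daniell_coverT.
Qed.

Lemma daniell_inf_le E s : daniell_cover E s -> daniell_inf E <= s.
Proof. by move=> Es; apply: ge_inf => //; exact: (has_inf_daniell E).2. Qed.

Lemma daniell_inf_ge E s : (forall t, daniell_cover E t -> s <= t) ->
  s <= daniell_inf E.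
Proof. by move=> h; apply: lb_le_inf; [exact: (has_inf_daniell E).1|exact: h]. Qed.

Lemma daniell_inf_ge0 E : 0 <= daniell_inf E.
Proof. by apply: daniell_inf_ge => t /daniell_cover_ge0. Qed.

Lemma daniell_outer0 : daniell_outer set0 = 0%E.
Proof.
congr (_%:E); apply/eqP; rewrite eq_le daniell_inf_ge0 andbT.
apply: daniell_inf_le; exists (fun _ _ => 0); split => //.
  by move=> _; exact: holder_cst.
by move=> _; rewrite functional_cst0.
Qed.

Lemma daniell_outer_ge0 E : (0 <= daniell_outer E)%E.
Proof. by rewrite lee_fin daniell_inf_ge0. Qed.

Lemma le_daniell_outer : {homo daniell_outer : E E' / E `<=` E' >-> (E <= E')%E}.
Proof.
move=> E E' EE; rewrite lee_fin; apply: daniell_inf_ge => t Et.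
by apply: daniell_inf_le; exact: daniell_coverS Et.
Qed.

Lemma daniell_outer_sigma_subadditive : sigma_subadditive daniell_outer.
Proof.
move=> E; set S := (\sum_(i <oo) _)%E.
have Sn n : (\sum_(0 <= i < n) daniell_outer (E i) <= S)%E.
  by apply: nneseries_lim_ge => i _ _; exact: daniell_outer_ge0.
have S0 : (0 <= S)%E by have := Sn 0%N; rewrite big_geq.
case: S S0 Sn => [S S0 Sn|_ _|//]; last by rewrite leey.
apply/lee_addgt0Pr => e e0; rewrite -EFinD lee_fin.
have h i : exists s, daniell_cover (E i) s /\ s < daniell_inf (E i) + e / 2 ^+ i.+1.
  have ei : 0 < e / 2 ^+ i.+1 by rewrite divr_gt0// exprn_gt0.
  by have [s Es sE] := inf_adherent ei (has_inf_daniell (E i)); exists s.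
have [s hs] := choice h.
have [F hF] := choice (fun i => (hs i).1).
have FH i k : holder alpha (F i k) by have [] := hF i.
have F0 i k x : 0 <= F i k x by have [] := hF i.
have Fnd i k x : F i k x <= F i k.+1 x by have [] := hF i.
apply: daniell_inf_le; exists (fun k x => \sum_(i < k) F i k x); split.
- by move=> k; exact: (@holder_sum R alpha k (fun i => F i k) (fun i => FH i k)).
- by move=> k x; apply: sumr_ge0.
- move=> k x; rewrite big_ord_recr/= ler_wpDr//.
  by apply: ler_sum => i _.
- move=> x [i _ Ex]; have [_ _ _ /(_ x Ex)[k0 Fk0] _] := hF i.
  (* The index must exceed [i], so that the [i]-th family occurs in the diagonal sum, and reach
     [k0], where that family is at least 1 at [x]. *)
  exists (maxn i.+1 k0); rewrite (le_trans Fk0)//.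
  rewrite (le_trans (le_nondecreasing_fun (Fnd i) x (leq_maxr i.+1 k0)))//.
  by rewrite (bigD1 (Ordinal (leq_maxl i.+1 k0)))//= lerDl sumr_ge0.
- move=> k; rewrite (functional_sum _ (fun i => FH i k)).
  have h1 : \sum_(i < k) l (F i k) <= \sum_(i < k) (daniell_inf (E i) + e / 2 ^+ i.+1).
    apply: ler_sum => i _; rewrite (le_trans _ (ltW (hs i).2))//.
    by have [] := hF i.
  rewrite (le_trans h1)// big_split/= lerD//.
    have := Sn k; rewrite big_mkord -lee_fin; apply: le_trans.
    by rewrite /daniell_outer sumEFin.
  exact: sum_half_pow_le (ltW e0).
Qed.

HB.instance Definition _ := isOuterMeasure.Build R T daniell_outer
  daniell_outer0 daniell_outer_ge0 le_daniell_outer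
  daniell_outer_sigma_subadditive.

(* A cover [F] of [X] splits as [F * u] and [F * (1 - u)] where the Lipschitz
   functions [u k] increase to the indicator of [U]. *)
Lemma daniell_open_caratheodory (U : set T) : open U -> daniell_outer.-caratheodory U.
Proof.
move=> oU; apply: le_caratheodory_measurable => X.
rewrite /daniell_outer -EFinD lee_fin.
apply: daniell_inf_ge => s [F [FH F0 Fnd FX Fs]].
pose phi : T -> R := \1_U.
have phi01 y : 0 <= phi y <= 1.
  by rewrite /phi indicE; case: (y \in U); rewrite ?lexx ?ler01.
have phiM y : `|phi y| <= 1 by have /andP[? ?] := phi01 y; rewrite ger0_norm.
pose u := lipreg phi.
have uH k : holder alpha (u k) by exact: (holder_lipreg phiM).
have u0 k x : 0 <= u k x by apply: (lipreg_ge_lb phiM) => y; case/andP: (phi01 y).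
have u1 k x : u k x <= 1.
  by rewrite (le_trans (lipreg_le phiM _ _))//; case/andP: (phi01 x).
have und k x : u k x <= u k.+1 x by exact: (lipreg_nd phiM).
have uU k x : (~` U) x -> u k x = 0.
  move=> Ux; apply/eqP; rewrite eq_le u0 andbT (le_trans (lipreg_le phiM _ _))//.
  by rewrite /phi indicE memNset.
(* The index of [u] is frozen at [K0], because [1 - u k] decreases in [k] and would spoil the
   monotonicity of the cover. The bound holds for every [K0], as the cover of the part inside [U]
   requires. *)
have key K0 : daniell_inf (X `&` ~` U) <= s - l (fun x => F K0 x * u K0 x).
  apply: daniell_inf_le; exists (fun K x => F (K0 + K)%N x * (1 - u K0 x)).
  have vH : holder alpha (fun x => 1 - u K0 x) by apply: holderB => //; exact: holder_cst.
  split.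
  - by move=> k; apply: (holderM halpha).
  - by move=> k x; rewrite mulr_ge0// subr_ge0.
  - by move=> k x; rewrite ler_wpM2r ?subr_ge0// addnS.
  - move=> x [Xx Ux]; have [k Fk] := FX x Xx; exists k.
    rewrite uU// subr0 mulr1 (le_trans Fk)//.
    by rewrite (le_nondecreasing_fun Fnd)// leq_addl.
  - move=> k; rewrite lerBrDr -lD; [|exact: (holderM halpha)|exact: (holderM halpha)].
    rewrite (le_trans _ (Fs (K0 + k)%N))//; apply: ler_functional => //.
      by apply: holderD; exact: (holderM halpha).
    move=> x; have : F K0 x * u K0 x <= F (K0 + k)%N x * u K0 x.
      by rewrite ler_wpM2r// (le_nondecreasing_fun Fnd)// leq_addr.
    lra.
rewrite -lerBrDr; apply: daniell_inf_le; exists (fun K x => F K x * u K x); split.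
- by move=> k; apply: (holderM halpha).
- by move=> k x; rewrite mulr_ge0.
- by move=> k x; rewrite ler_pM.
- move=> x [Xx Ux]; have [k Fk] := FX x Xx.
  have [|k0 uk] := @lipreg_ge_near _ _ _ phiM x 1.
    have := open_nbhs_nbhs (conj oU Ux); apply: filterS => y Uy.
    by rewrite /phi indicE mem_set.
  exists (maxn k k0); rewrite -[leLHS]mulr1 ler_pM//.
    by rewrite (le_trans Fk)// (le_nondecreasing_fun Fnd)// leq_maxl.
  by rewrite uk// leq_maxr.
- by move=> k; have := key k; lra.
Qed.

Lemma daniell_borel_caratheodory (B : set T) :
  measurable B -> daniell_outer.-caratheodory B.
Proof.
suff : <<s @open T >> `<=` daniell_outer.-cara.-measurable by exact.
apply: smallest_sub; last by move=> U oU; exact: daniell_open_caratheodory.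
split => //; [by move=> X mX; rewrite setTD; exact: measurableC |
              by move=> u_ mu_; exact: bigcupT_measurable].
Qed.

Hypothesis ltight : forall s, daniell_cover setT s -> 1 <= s.

(** A copy of [daniell_outer], which already carries the outer measure structure. The hypothesis
    [ltight] gives it total mass 1, excluding a loss of mass at infinity. *)
Definition daniell_measure (B : set T) : \bar R := daniell_outer B.

Let daniell_measure0 : daniell_measure set0 = 0%E.
Proof. exact: daniell_outer0. Qed.

Let daniell_measure_ge0 B : (0 <= daniell_measure B)%E.
Proof. exact: daniell_outer_ge0. Qed.

Let daniell_measure_sigma_additive : semi_sigma_additive daniell_measure.
Proof.
move=> F mF tF mUF; rewrite /daniell_measure.
apply: (@caratheodory_measure_sigma_additive R T daniell_outer) => //.
  by move=> i; exact: (daniell_borel_caratheodory (mF i)).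
exact: (daniell_borel_caratheodory mUF).
Qed.

HB.instance Definition _ := isMeasure.Build _ T R daniell_measure
  daniell_measure0 daniell_measure_ge0 daniell_measure_sigma_additive.

Let daniell_measureT : daniell_measure setT = 1%E.
Proof.
congr (_%:E); apply/eqP; rewrite eq_le; apply/andP; split.
  by apply: daniell_inf_le; exact: daniell_coverT.
exact: daniell_inf_ge.
Qed.

HB.instance Definition _ := Measure_isProbability.Build _ T R daniell_measure
  daniell_measureT.

Local Notation mu := (daniell_measure : probability (rseq R) R).

(* Layer cake: [v <= 1 + \sum_(j < n) 1_(j + 1 <= v)], and each level set is
   covered by [min v (j + 1) - min v j]. *)
Lemma daniell_measure_integral_le n v : holder alpha v -> (forall x, 0 <= v x) ->
  (forall x, v x <= n.+1%:R) -> \int[mu]_x v x <= 1 + l v.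
Proof.
move=> vH v0 vn.
pose a j : set T := [set x | j.+1%:R <= v x].
have ma j : measurable (a j).
  rewrite (_ : a j = v @^-1` `[j.+1%:R, +oo[); last first.
    by apply/seteqP; split => x /=; rewrite in_itv/= andbT.
  rewrite -[X in measurable X]setTI.
  by apply: continuous_measurable_rseq => //; exact: (holder_continuous halpha).
have pw : forall (m : nat) (y : R), y <= m.+1%:R ->
    y <= 1 + \sum_(j < m) (if j.+1%:R <= y then 1 else 0).
  elim=> [|m IH] y ym; first by rewrite big_ord0 addr0.
  have [ym'|my] := leP y m.+1%:R.
    rewrite (le_trans (IH _ ym'))// lerD2l big_ord_recr/= lerDl.
    by case: ifP.
  rewrite (eq_bigr (fun=> 1)) => [|j _]; last first.
    by rewrite ifT// (le_trans _ (ltW my))// ler_nat.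
  by rewrite sumr_const card_ord (le_trans ym)// nat1r.
pose p j x := Num.min (v x) j.+1%:R - Num.min (v x) j%:R.
have pH j : holder alpha (p j) by apply: holderB; exact: holder_minc.
have pa j : fine (mu (a j)) <= l (p j).
  apply: daniell_inf_le; exists (fun=> p j); split => //.
  - move=> _ x; rewrite subr_ge0 le_min ge_min lexx/= ge_min.
    by rewrite ler_nat leqnSn orbT.
  - move=> x jv; exists 0%N; rewrite /p !min_r// -?natr1 ?(addrC j%:R) ?addrK//.
    by rewrite (le_trans _ jv)// ler_nat.
have ib j : mu.-integrable setT (EFin \o \1_(a j)).
  by apply: integrable_indic => //; rewrite (le_lt_trans (probability_le1 mu _))// ltry.
have J1 j : \int[mu]_x \1_(a j) x = fine (mu (a j)).
  by rewrite /Rintegral integral_indic// setIT.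
have int_sum m : mu.-integrable setT (EFin \o (fun x => \sum_(j < m) \1_(a j) x)) /\
    \int[mu]_x (\sum_(j < m) \1_(a j) x) <= \sum_(j < m) l (p j).
  elim: m => [|m [im Jm]].
    have -> : (fun x => \sum_(j < 0) \1_(a j) x) = fun=> 0 :> R.
      by apply/funext => x; rewrite big_ord0.
    rewrite Rintegral_probability_cst big_ord0; split => //.
    by apply: bc_integrable_probability; exact: bc_cst.
  have -> : (fun x => \sum_(j < m.+1) \1_(a j) x) =
      fun x => \sum_(j < m) \1_(a j) x + \1_(a m) x :> R.
    by apply/funext => x; rewrite big_ord_recr.
  split; last by rewrite RintegralD// J1 big_ord_recr/= lerD ?pa.
  exact: (integrableD measurableT im (ib m)).
have ic : mu.-integrable setT (EFin \o (fun=> 1)).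
  by apply: bc_integrable_probability; exact: bc_cst.
have [im Jm] := int_sum n.
have iv : mu.-integrable setT (EFin \o v).
  by apply: bc_integrable_probability; exact: (holder_bc halpha).
apply: (@le_trans _ _ (\int[mu]_x (1 + \sum_(j < n) \1_(a j) x))).
  apply: le_Rintegral => //; first exact: (integrableD measurableT ic im).
  move=> x _; rewrite (le_trans (pw n _ (vn x)))// lerD2l; apply: ler_sum => j _.
  by rewrite indicE; case: ifPn => [jv|_]; rewrite ?ler0n// mem_set.
rewrite RintegralD// Rintegral_probability_cst lerD2l (le_trans Jm)//.
(* The differences [p j] telescope to the minimum of [v] and [n], which is at most [v]. *)
rewrite -functional_sum//; apply: ler_functional => //; first exact: holder_sum.
move=> x; rewrite (eq_bigr (fun j : 'I_n => (fun k : nat => Num.min (v x) k%:R) j.+1 -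
  (fun k : nat => Num.min (v x) k%:R) j))//.
rewrite -(big_mkord xpredT (fun j => Num.min (v x) j.+1%:R - Num.min (v x) j%:R)).
rewrite (@telescope_sumr _ 0 n (fun j => Num.min (v x) j%:R))//.
by rewrite [Num.min _ 0%:R]min_r// subr0 ge_min lexx.
Qed.

(** Homogeneity removes the additive error 1 of [daniell_measure_integral_le]: apply it to [N * w]
    with [N] large. *)
Lemma daniell_measure_integral_ge0 w : holder alpha w -> (forall x, 0 <= w x) ->
  \int[mu]_x w x <= l w.
Proof.
move=> wH w0; have [M M0 wM] := holder_bounded halpha wH.
have iw : mu.-integrable setT (EFin \o w).
  by apply: bc_integrable_probability; exact: (holder_bc halpha).
have key (N : nat) : N%:R * \int[mu]_x w x <= 1 + N%:R * l w.
  rewrite -RintegralZl// -lZ//.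
  apply: (@daniell_measure_integral_le (Num.trunc (N%:R * M))).
  - exact: holderZ.
  - by move=> x; rewrite mulr_ge0.
  - move=> x; rewrite ltW// (le_lt_trans _ (truncnS_gt _))// ler_wpM2l//.
    by rewrite (le_trans (ler_norm _)).
rewrite leNgt; apply/negP => h.
pose d := \int[mu]_x w x - l w; have d0 : 0 < d by rewrite subr_gt0.
have := key (Num.trunc d^-1).+1.
have : 1 < (Num.trunc d^-1).+1%:R * d by rewrite -ltr_pdivrMr// mul1r truncnS_gt.
by rewrite /d; lra.
Qed.

(** With [M] a bound of [w], the inequality for the nonnegative functions [w + M] and [M - w] gives
    both directions, since integral and functional agree on constants. *)
Lemma daniell_measure_integral w : holder alpha w -> \int[mu]_x w x = l w.
Proof.
move=> wH; have [M M0 wM] := holder_bounded halpha wH.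
have iw : mu.-integrable setT (EFin \o w).
  by apply: bc_integrable_probability; exact: (holder_bc halpha).
have ic : mu.-integrable setT (EFin \o (fun=> M)).
  by apply: bc_integrable_probability; exact: bc_cst.
have lM : l (fun=> M) = M.
  rewrite -[RHS]mulr1 -[in RHS]l1 -lZ; last exact: holder_cst.
  by congr l; apply/funext => x; rewrite mulr1.
have MH := holder_cst alpha M.
have h x : - M <= w x <= M by rewrite -ler_norml.
apply/eqP; rewrite eq_le; apply/andP; split.
  have := @daniell_measure_integral_ge0 (fun x => w x + M) (holderD wH MH).
  rewrite lD// RintegralD// Rintegral_probability_cst lM lerD2r; apply => x.
  by have /andP[? ?] := h x; lra.
have := @daniell_measure_integral_ge0 (fun x => M - w x) (holderB MH wH).
rewrite functionalB// RintegralB// Rintegral_probability_cst lM lerD2l lerN2; apply => x.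
by have /andP[? ?] := h x; lra.
Qed.

End daniell.

Lemma daniell_representation (R : realType) (alpha : R) (halpha : 0 < alpha <= 1)
    (l : (rseq R -> R) -> R)
    (lD : forall g h, holder alpha g -> holder alpha h ->
      l (fun x => g x + h x) = l g + l h)
    (lZ : forall k g, holder alpha g -> l (fun x => k * g x) = k * l g)
    (l0 : forall g, holder alpha g -> (forall x, 0 <= g x) -> 0 <= l g)
    (l1 : l (fun=> 1) = 1)
    (ltight : forall s, daniell_cover alpha l setT s -> 1 <= s) :
  exists mu : probability (rseq R) R, forall w, holder alpha w ->
    \int[mu]_x w x = l w.
Proof.
eexists => w wH; exact: (daniell_measure_integral halpha lD lZ l0 l1 ltight wH).
Qed.

(** * Tightness *)

(** Tychonoff's theorem gives a cluster point in the product topology; by [cvg_rseq] metric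
    neighbourhoods are product neighbourhoods, so it is a cluster point for the metric. *)
Lemma rseq_box_compact (R : realType) (a b : nat -> R) :
  compact [set x : rseq R | forall i, a i <= x i <= b i].
Proof.
move=> F FF FQ.
have := @tychonoff nat (fun=> R) _ (fun i => @segment_compact R (a i) (b i)).
move=> /(_ F FF); case.
  by apply: filterS FQ => x h i /=; rewrite in_itv/=; exact: h.
move=> p [/= pab pF]; exists (p : rseq R); split.
  by move=> i; have := pab i; rewrite /= in_itv.
move=> U V FU pV; apply: pF => //.
apply: (@cvg_rseq R p (nbhs p) _ _ V pV) => i.
exact: (@proj_continuous nat (fun=> R) i p).
Qed.

Section tightness.
Context {R : realType} (f : R -> R).
Hypotheses (hfpos : forall a, 0 < f a) (hfcont : continuous f)
  (hfint : (\int[lebesgue_measure]_a (f a)%:E = 1)%E).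
Context (alpha : R) (halpha : 0 < alpha <= 1).
Local Notation T := (rseq R).

(** A cut-off near infinity: for positive [k] it is at least 1 when [|atan a|] is within [1 / k] of
    [pi / 2], and 0 when it is farther than [2 / k]. It depends on [atan a] so as to be Lipschitz
    for the metric. *)
Definition tail_cut (k : nat) (a : R) : R :=
  Num.max (2 - k%:R * (pi / 2 - `|atan a|)) 0.

Lemma tail_cut_ge0 k a : 0 <= tail_cut k a.
Proof. by rewrite le_max lexx orbT. Qed.

Lemma tail_cut_le2 k a : tail_cut k a <= 2.
Proof.
rewrite ge_max ler0n andbT gerBl mulr_ge0// subr_ge0 ler_norml.
by rewrite lerNl -atanN !(ltW (atan_ltpi2 _)).
Qed.

Lemma tail_cut_lipschitz k a b :
  `|tail_cut k a - tail_cut k b| <= k%:R * `|atan a - atan b|.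
Proof.
have key c d : tail_cut k c - tail_cut k d <= k%:R * `|atan c - atan d|.
  rewrite lerBlDr {1}/tail_cut ge_max; apply/andP; split; last first.
    by rewrite addr_ge0 ?tail_cut_ge0 ?mulr_ge0.
  rewrite (@le_trans _ _ (k%:R * `|atan c - atan d| + (2 - k%:R * (pi / 2 - `|atan d|))))//.
    have : k%:R * (`|atan c| - `|atan d|) <= k%:R * `|atan c - atan d|.
      by rewrite ler_wpM2l// lerB_dist.
    lra.
  by rewrite lerD2l le_max lexx.
rewrite ler_norml key andbT; have := key b a; rewrite distrC; lra.
Qed.

Lemma holder_tail_cut k i : holder alpha (fun x : T => tail_cut k (x i)).
Proof.
by apply: (holder_coord halpha i (ler0n R k)); exact: tail_cut_lipschitz.
Qed.

Lemma tail_cut_cvg a : tail_cut ^~ a @ \oo --> (0 : R).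
Proof.
have a0 : 0 < pi / 2 - `|atan a|.
  by rewrite subr_gt0 ltr_norml atan_ltpi2 atan_gtNpi2.
pose n := (Num.trunc (2 / (pi / 2 - `|atan a|))).+1.
apply: (@cvg_trans _ (cst 0 @ \oo)); last exact: cvg_cst.
apply: near_eq_cvg; exists n => // k /= nk.
rewrite /tail_cut max_r//.
have : 2 <= k%:R * (pi / 2 - `|atan a|).
  rewrite -ler_pdivrMr// (le_trans (ltW (truncnS_gt _)))// ler_nat//.
lra.
Qed.

Lemma wint_tail_cut_small (e : R) : 0 < e ->
  exists k, wint f (tail_cut k.+1) <= e.
Proof.
move=> e0.
have bc k : bounded_continuous (tail_cut k).
  exact: (bc_prepend (g := fun x => tail_cut k (x 0%N)) point
    (holder_bc halpha (holder_tail_cut k 0%N))).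
have : wint f (tail_cut k) @[k --> \oo] --> wint f (fun=> 0).
  apply: (wint_cvg hfpos hfcont hfint (M := 2)) => //.
    by move=> n a; rewrite ger0_norm ?tail_cut_ge0 ?tail_cut_le2.
  exact: tail_cut_cvg.
rewrite (wint_cst hfpos hfcont hfint) => /cvgr_le /(_ _ e0)[k _ h].
by exists k; apply: h => /=.
Qed.

Context (l : (T -> R) -> R).
Hypotheses
  (lD : forall g h, holder alpha g -> holder alpha h ->
    l (fun x => g x + h x) = l g + l h)
  (lZ : forall k g, holder alpha g -> l (fun x => k * g x) = k * l g)
  (l0 : forall g, holder alpha g -> (forall x, 0 <= g x) -> 0 <= l g)
  (l1 : l (fun=> 1) = 1).
Context (C : R).
Hypotheses (C0 : 0 <= C)
  (lC : forall i k, l (fun x : T => tail_cut k (x i)) <= C * wint f (tail_cut k)).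

(* By compactness one [F K] exceeds [1 - e] on a box, hence [1 - 2 * e] on a
   cylinder around it; off the cylinder the tail cuts compensate. *)
Lemma tight_cover s : daniell_cover alpha l setT s -> 1 <= s.
Proof.
move=> [F [FH F0 Fnd FT Fs]]; apply/ler_addgt0Pr => e0 e00.
(* Two of the three shares of [e0] are spent in the pointwise bound [pw], one on the tail cuts. *)
pose e := e0 / 3; have e_gt0 : 0 < e by rewrite divr_gt0.
have /choice[k kP] : forall i, exists k, C * wint f (tail_cut k.+1) <= e / 2 ^+ i.+1.
  move=> i; have [|k hk] := @wint_tail_cut_small (e / 2 ^+ i.+1 / (C + 1)).
    by rewrite !divr_gt0 ?exprn_gt0// ltr_wpDl.
  exists k; rewrite (le_trans (ler_wpM2l C0 hk))//.
  rewrite mulrCA ler_piMr ?divr_ge0 ?exprn_ge0 ?(ltW e00)//.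
  by rewrite ler_pdivrMr ?ltr_wpDl// mul1r lerDl.
(* At [|atan a| = t i] the cut-off of index [(k i).+1] equals 1. Since [t i] is nonnegative, 0 is an
   admissible coordinate in the box [Q]. *)
pose t i : R := pi / 2 - (k i).+1%:R^-1.
have pih := @pihalf_ge1 R.
have ki i : 0 < ((k i).+1%:R^-1 : R) <= 1.
  by rewrite invr_gt0 ltr0n/= invf_le1 ?ltr0n// ler1n.
have t0 i : 0 <= t i by rewrite subr_ge0 (le_trans _ pih)//; case/andP: (ki i).
have tp i : t i < pi / 2 by rewrite ltrBlDr ltrDl; case/andP: (ki i).
pose Q := [set x : T | forall i, tan (- t i) <= x i <= tan (t i)].
have inQ a i : `|atan a| <= t i -> tan (- t i) <= a <= tan (t i).
  rewrite ler_norml => /andP[h1 h2].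
  have tK1 : atan (tan (t i)) = t i.
    by rewrite tanK// in_itv/= tp andbT (lt_le_trans _ (t0 i))// oppr_lt0; lra.
  have tK2 : atan (tan (- t i)) = - t i.
    rewrite tanK// in_itv/= ltrN2 tp/= (le_lt_trans _ (_ : 0 < pi / 2))//; last lra.
    by rewrite oppr_le0.
  rewrite !leNgt; apply/andP; split; apply/negP => /lt_atan.
    by rewrite tK2 ltNge h1.
  by rewrite tK1 ltNge h2.
(* A Dini argument: bad points for every [K] would cluster at some [p] in the box; some [F K0] is at
   least 1 at [p], hence above [1 - e] nearby, against monotonicity in [K]. *)
have [K FK] : exists K, forall x, Q x -> 1 - e <= F K x.
  apply: contrapT => /forallNP h.
  have /choice[x xP] : forall K, exists x, Q x /\ F K x < 1 - e.
    move=> K; have /existsNP[x /not_implyP[Qx /negP]] := h K.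
    by rewrite -ltNge => ?; exists x.
  have [] := @rseq_box_compact R (fun i => tan (- t i)) (fun i => tan (t i)) (x @ \oo).
    by exists 0%N => // n _; exact: (xP n).1.
  move=> p [_ px]; have [K0 hK0] := FT p I.
  have [||y [[n /= nK0 <-] hy]] := px [set x n | n in [set n | (K0 <= n)%N]] [set y | 1 - e < F K0 y].
  - by exists K0 => // n /= nK0; exists n.
  - have := @holder_continuous _ _ halpha _ (FH K0) p.
    by move=> /cvgr_gt; apply; lra.
  - have := (xP n).2; rewrite ltNge => /negP; apply.
    by rewrite (le_trans (ltW hy))// (le_nondecreasing_fun Fnd).
have /holderP[CK CK0 hCK] := FH K.
have theta01 : 0 <= theta alpha < 1.
  by rewrite (ltW (theta_gt0 _))/= theta_lt1.
have [N hN] := geo_small CK theta01 e_gt0.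
have pw x : 1 <= (F K x + 2 * e) + \sum_(i < N) tail_cut (k i).+1 (x i).
  have [hx|/existsNP[i /not_implyP[iN /negP hi]]] :=
      pselect (forall i, (i < N)%N -> `|atan (x i)| <= t i).
    rewrite ler_wpDr ?sumr_ge0//; first by move=> i _; exact: tail_cut_ge0.
    (* Replacing the coordinates from [N] on by 0 lands in the box and moves [F K] by less than
       [e]. *)
    pose y : T := fun i => if (i < N)%N then x i else 0.
    have Qy : Q y.
      move=> i; apply: inQ; rewrite /y; case: ifPn => [|_]; first exact: hx.
      by rewrite atan0 normr0.
    have dxy : mdist x y <= 2^-1 ^+ N.
      by apply: rseq_mdist_tail => i iN; rewrite /y iN.
    have Dxy : hdist alpha x y <= theta alpha ^+ N.
      have -> : theta alpha ^+ N = (2^-1 ^+ N) `^ alpha.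
        elim: (N) => [|n IH]; first by rewrite !expr0 powR1.
        by rewrite !exprS IH powRM.
      have a0 : 0 <= alpha by case/andP: halpha => /ltW.
      by rewrite /hdist ge0_ler_powR ?nnegrE ?mdist_ge0.
    have h1 := FK y Qy.
    have h2 : CK * hdist alpha x y <= CK * theta alpha ^+ N by rewrite ler_wpM2l.
    have := hCK x y; rewrite ler_norml => /andP[? _].
    lra.
  rewrite -ltNge in hi.
  rewrite (bigD1 (Ordinal iN))//=.
  have h1 : 1 <= tail_cut (k i).+1 (x i).
    rewrite le_max; apply/orP; left.
    have : (k i).+1%:R * (pi / 2 - `|atan (x i)|) <= (k i).+1%:R * (k i).+1%:R^-1 :> R.
      by rewrite ler_wpM2l// lerBlDr -lerBlDl ltW.
    rewrite divff ?pnatr_eq0//; lra.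
  have h2 : 0 <= \sum_(j < N | j != Ordinal iN) tail_cut (k j).+1 (x j).
    by apply: sumr_ge0 => j _; exact: tail_cut_ge0.
  have := F0 K x; lra.
have GH : holder alpha (fun x : T => \sum_(i < N) tail_cut (k i).+1 (x i)).
  exact: (@holder_sum R alpha N (fun i (x : T) => tail_cut (k i).+1 (x i))
    (fun i => holder_tail_cut (k i).+1 i)).
have EH : holder alpha (fun _ : T => 2 * e) by exact: holder_cst.
have lE (c : R) : l (fun=> c) = c.
  rewrite -[RHS]mulr1 -[in RHS]l1 -lZ; last exact: holder_cst.
  by congr l; apply/funext => x; rewrite mulr1.
have := @ler_functional _ _ _ lD lZ l0 _ _ (holder_cst alpha 1) (holderD (holderD (FH K) EH) GH) pw.
rewrite l1 lD//; last exact: holderD.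
rewrite lD// lE.
rewrite (@functional_sum _ _ _ lD lZ N (fun i (x : T) => tail_cut (k i).+1 (x i))); last first.
  by move=> i; exact: holder_tail_cut.
have : \sum_(i < N) l (fun x : T => tail_cut (k i).+1 (x i)) <= e.
  rewrite (@le_trans _ _ (\sum_(i < N) e / 2 ^+ i.+1))//.
    by apply: ler_sum => i _; rewrite (le_trans (lC _ _)).
  exact: sum_half_pow_le (ltW e_gt0).
have := Fs K; rewrite /e; lra.
Qed.

End tightness.

(** * Measures with a density *)

Section density_probability.
Context d (T : measurableType d) (R : realType) (mu : probability T R).
Context (h : T -> R) (mh : measurable_fun setT h) (h0 : forall x, 0 <= h x)
  (h1 : (\int[mu]_x (h x)%:E = 1)%E).
Local Open Scope ereal_scope.

Definition density_measure (B : set T) : \bar R := \int[mu]_(x in B) (h x)%:E.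

Let density_measure0 : density_measure set0 = 0.
Proof. by rewrite /density_measure integral_set0. Qed.

Let density_measure_ge0 B : 0 <= density_measure B.
Proof. by apply: integral_ge0 => x _; rewrite lee_fin. Qed.

Let density_measure_sigma_additive : semi_sigma_additive density_measure.
Proof.
move=> F mF tF mUF; rewrite /density_measure ge0_integral_bigcup//=; last 2 first.
- by apply/measurable_EFinP; exact: measurable_funTS.
- by move=> x _; rewrite lee_fin.
by apply: is_cvg_ereal_nneg_natsum_cond => n _ _; exact: density_measure_ge0.
Qed.

HB.instance Definition _ := isMeasure.Build _ _ _ density_measure
  density_measure0 density_measure_ge0 density_measure_sigma_additive.

Let density_measureT : density_measure setT = 1.
Proof. exact: h1. Qed.

HB.instance Definition _ := Measure_isProbability.Build _ _ _ density_measure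
  density_measureT.

Lemma density_probability : exists rho : probability T R,
  forall B, rho B = \int[mu]_(x in B) (h x)%:E.
Proof. by exists (density_measure : probability T R). Qed.

(** Since [h] is almost everywhere the Radon-Nikodym derivative of [rho], the change of variables
    for that derivative applies. *)
Lemma integral_density (rho : probability T R) (g : T -> R) :
  (forall B, measurable B -> rho B = \int[mu]_(x in B) (h x)%:E) ->
  rho.-integrable setT (EFin \o g) ->
  \int[rho]_x (g x)%:E = \int[mu]_x (g x * h x)%:E.
Proof.
move=> rhoE ig.
have dom : rho `<< mu.
  apply/null_content_dominatesP => B mB muB.
  by rewrite rhoE// null_set_integral//; apply/measurable_EFinP; exact: measurable_funTS.
have ih : mu.-integrable setT (EFin \o h).
  apply/integrableP; split; first exact/measurable_EFinP.
  under eq_integral do rewrite /= ger0_norm//.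
  by rewrite h1 ltry.
have mg := measurable_int _ ig.
rewrite -(Radon_Nikodym_change_of_variables dom)//=.
apply: ae_eq_integral => //.
- apply: emeasurable_funM => //; apply: (measurable_int mu).
- have /measurable_EFinP mg' := mg.
  have /measurable_EFinP : measurable_fun setT (fun x => g x * h x)%R by exact: measurable_funM.
  exact.
- rewrite (_ : (fun x => (g x * h x)%:E) = fun x => (g x)%:E * (h x)%:E)//.
  apply: ae_eqe_mul2l => /=.
  rewrite Radon_NikodymE//=.
  case: cid => /= k [k1 k2 k3].
  apply: integral_ae_eq => //=.
  + exact/measurable_EFinP.
  + by move=> E _ mE; rewrite -k3//= rhoE.
Qed.

End density_probability.

(** * The Gibbs state and the main theorem *)

Section ruelle_bc.
Context {R : realType} (f : R -> R).
Hypotheses (hfpos : forall a, 0 < f a) (hfcont : continuous f)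
  (hfint : (\int[lebesgue_measure]_a (f a)%:E = 1)%E).
Context (alpha : R) (halpha : 0 < alpha <= 1).
Context (A : rseq R -> R) (hA : holder alpha A).
Local Notation L := (ruelle f A).
Implicit Types (x y : rseq R) (g h phi : rseq R -> R).

Lemma lipreg_bc phi M k : (forall x, `|phi x| <= M) -> bounded_continuous (lipreg phi k).
Proof. by move=> phiM; apply: (holder_bc halpha); exact: (holder_lipreg phiM). Qed.

(* [L phi] is the increasing limit of the continuous functions
   [L (lipreg phi k)], hence lower semicontinuous. *)
Lemma ruelle_lsc phi x (e : R) : bounded_continuous phi -> 0 < e ->
  \forall y \near x, L phi x - e <= L phi y.
Proof.
move=> bphi e0; have [cphi [M phiM]] := iffLR (bounded_continuousP phi) bphi.
have bl k := lipreg_bc k phiM.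
have : L (lipreg phi k) x @[k --> \oo] --> L phi x.
  apply: (ruelle_cvg hfpos hfcont hfint halpha hA (M := M)) => //.
    by move=> n y; exact: (lipreg_norm phiM).
  by move=> y; exact: (lipreg_cvg phiM).
have e2 : 0 < e / 2 by rewrite divr_gt0.
move=> /cvgr_gt /(_ (L phi x - e / 2)) [|k _ /(_ k (leqnn k)) hk]; first by lra.
have Lc : continuous (L (lipreg phi k)).
  apply: (holder_continuous halpha); apply: (holder_ruelle hfpos hfcont hfint halpha hA).
  exact: (holder_lipreg phiM).
have /cvgr_gt /(_ (L (lipreg phi k) x - e / 2)) := Lc x.
move=> /(_ ltac:(lra)); apply: filterS => y hy.
have : L (lipreg phi k) y <= L phi y.
  apply: (ler_ruelle hfpos hfcont hfint halpha hA) => // z.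
  exact: (lipreg_le phiM).
move: hk hy; rewrite /=; move: (L phi x) (L phi y) (L (lipreg phi k) x) (L (lipreg phi k) y).
by move=> a b c d; lra.
Qed.

(** Lower semicontinuity for [phi] and for [-1 * phi] gives continuity. *)
Lemma bc_ruelle phi : bounded_continuous phi -> bounded_continuous (L phi).
Proof.
move=> bphi; have [cphi [M phiM]] := iffLR (bounded_continuousP phi) bphi.
apply/bounded_continuousP; split; last first.
  have [MA MA0 AM] := holder_bounded halpha hA.
  by exists (expR MA * M); exact: (ler_norm_ruelle hfpos hfcont hfint halpha hA).
move=> x; apply/(@cvgrPdist_le _ _ _ (nbhs x)) => e e0.
have bN := bcZ (-1) bphi.
have h1 := ruelle_lsc x bphi e0; have h2 := ruelle_lsc x bN e0.
rewrite (ruelleZ hfpos hfcont hfint halpha hA)// in h2.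
near=> y.
have : L phi x - e <= L phi y by near: y; exact: h1.
have : -1 * L phi x - e <= -1 * L phi y by near: y; exact: h2.
by move=> ? ?; rewrite ler_norml; apply/andP; split; lra.
Unshelve. all: by end_near. Qed.

End ruelle_bc.

(** * The invariant functional and the Gibbs state *)

Section gibbs.
Context {R : realType} (f : R -> R).
Hypotheses (hfpos : forall a, 0 < f a) (hfcont : continuous f)
  (hfint : (\int[lebesgue_measure]_a (f a)%:E = 1)%E).
Context (alpha : R) (halpha : 0 < alpha <= 1).
Context (G : rseq R -> R) (hG : holder alpha G).
Local Notation P := (ruelle f G).
Implicit Types (x y : rseq R) (g h w phi : rseq R -> R).
Hypothesis P_cst : forall c : R, P (fun=> c) = fun=> c.
Context (r : R) (r01 : 0 <= r < 1).
Hypothesis P_mixing : forall g, holder alpha g -> exists R0 : R, forall n k x y,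
  `|iter (n + k) P g x - iter n P g y| <= R0 * r ^+ n.

(** Any base point would do: by [P_mixing] the iterates of a Hölder function approach the same
    constant everywhere. *)
Definition gibbs_mean g : R := limn (fun n => iter n P g point).

Lemma gibbs_mean_gap g : holder alpha g -> exists R0 : R, forall n x,
  `|gibbs_mean g - iter n P g x| <= R0 * r ^+ n.
Proof.
move=> gH; have [R0 hR] := P_mixing gH; exists R0 => n x.
have [cg _] := geo_cauchy r01 (fun n k => hR n k point point).
have h : `|iter k P g point - iter n P g x| @[k --> \oo] -->
    `|gibbs_mean g - iter n P g x|.
  by apply: cvg_norm; apply: cvgB => //; exact: cvg_cst.
rewrite -(cvg_lim _ h)//; apply: limr_le; first by apply/cvg_ex; eexists; exact: h.
by exists n => // k /= nk; rewrite -(subnKC nk).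
Qed.

Lemma gibbs_mean_cvg g x : holder alpha g ->
  iter n P g x @[n --> \oo] --> gibbs_mean g.
Proof.
move=> gH; have [R0 hR] := gibbs_mean_gap gH.
apply/cvgrPdist_lt => e e0; have [N hN] := geo_small R0 r01 e0.
have [r0 r1] := andP r01.
have R00 : 0 <= R0 by have := hR 0%N point; rewrite expr0 mulr1; apply: le_trans.
exists N => // n /= Nn; rewrite (le_lt_trans (hR n x))// (le_lt_trans _ hN)//.
by rewrite ler_wpM2l// ler_wiXn2l// ltW.
Qed.

Lemma gibbs_mean_unique g x (c : R) : holder alpha g ->
  iter n P g x @[n --> \oo] --> c -> gibbs_mean g = c.
Proof.
by move=> gH h; rewrite -(cvg_lim _ (gibbs_mean_cvg x gH))//; exact/cvg_lim.
Qed.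

Lemma gibbs_meanD g h : holder alpha g -> holder alpha h ->
  gibbs_mean (fun x => g x + h x) = gibbs_mean g + gibbs_mean h.
Proof.
move=> gH hH; apply: (@gibbs_mean_unique _ point); first exact: holderD.
under eq_fun do rewrite (iter_ruelleD hfpos hfcont hfint halpha hG _ gH hH).
by apply: cvgD; exact: gibbs_mean_cvg.
Qed.

Lemma gibbs_meanZ (k : R) g : holder alpha g ->
  gibbs_mean (fun x => k * g x) = k * gibbs_mean g.
Proof.
move=> gH; apply: (@gibbs_mean_unique _ point); first exact: holderZ.
under eq_fun do rewrite (iter_ruelleZ hfpos hfcont hfint halpha hG _ _ gH).
by apply: cvgM; [exact: cvg_cst|exact: gibbs_mean_cvg].
Qed.

Lemma iter_ruelle_cst n (c : R) : iter n P (fun=> c) = fun=> c.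
Proof. by elim: n => //= n ->. Qed.

Lemma gibbs_mean_cst (c : R) : gibbs_mean (fun=> c) = c.
Proof.
apply: (@gibbs_mean_unique _ point); first exact: holder_cst.
by under eq_fun do rewrite iter_ruelle_cst; exact: cvg_cst.
Qed.

Lemma gibbs_mean_ge0 g : holder alpha g -> (forall x, 0 <= g x) -> 0 <= gibbs_mean g.
Proof.
move=> gH g0; have h := @gibbs_mean_cvg g point gH.
rewrite -(cvg_lim _ h)//; apply: limr_ge; first by apply/cvg_ex; eexists; exact: h.
apply: nearW => n.
have -> : 0 = iter n P (fun=> 0) point by rewrite iter_ruelle_cst.
by apply: (ler_iter_ruelle hfpos hfcont hfint halpha hG) => //; exact: holder_cst.
Qed.

Lemma gibbs_mean_ruelle g : holder alpha g -> gibbs_mean (P g) = gibbs_mean g.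
Proof.
move=> gH; have PH := holder_ruelle hfpos hfcont hfint halpha hG gH.
apply: (@gibbs_mean_unique _ point) => //.
have -> : (fun n => iter n P (P g) point) = (fun n => iter n.+1 P g point).
  by apply/funext => n; rewrite iterSr.
by rewrite (cvg_shiftS (fun n => iter n P g point)); exact: gibbs_mean_cvg.
Qed.

(** At [prepend a x] the composite is [g x] for every [a], and [P] fixes constants. This is the
    source of shift invariance. *)
Lemma ruelle_comp_shift g : bounded_continuous g -> P (fun x => g (Defs.shift x)) = g.
Proof.
move=> bg; apply/funext => x.
have := congr1 (@^~ x) (P_cst (g x)); rewrite !ruelleE => h.
by rewrite -[RHS]h.
Qed.

Lemma gibbs_mean_shift g : holder alpha g ->
  gibbs_mean (fun x => g (Defs.shift x)) = gibbs_mean g.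
Proof.
move=> gH; rewrite -gibbs_mean_ruelle; last exact: (holder_shift halpha gH).
by rewrite ruelle_comp_shift//; exact: (holder_bc halpha).
Qed.

(** For coordinate 0 apply [P] once: it integrates the cut-off over the prepended symbol with weight
    at most [expR M]. Shift invariance carries the bound to the other coordinates. *)
Lemma gibbs_mean_tail : exists2 C : R, 0 <= C & forall i k,
  gibbs_mean (fun x : rseq R => tail_cut k (x i)) <= C * wint f (tail_cut k).
Proof.
have [M M0 GM] := holder_bounded halpha hG.
exists (expR M) => [|i k]; first exact: expR_ge0.
have tH j := holder_tail_cut halpha k j.
elim: i => [|i IH]; last first.
  by rewrite (gibbs_mean_shift (tH i)).
rewrite -(gibbs_mean_ruelle (tH 0%N)) -[leRHS]gibbs_mean_cst.
apply: (@ler_functional _ _ _ gibbs_meanD gibbs_meanZ gibbs_mean_ge0).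
- exact: (holder_ruelle hfpos hfcont hfint halpha hG).
- exact: holder_cst.
- have bt := holder_bc halpha (tH 0%N).
  have bc : bounded_continuous (tail_cut k : R -> R).
    exact: (bc_prepend point bt).
  move=> x; rewrite ruelleE -(wintZ hfpos hfcont hfint)//.
  apply: (ler_wint hfpos hfcont hfint).
  + exact: (bc_ruelle_integrand halpha hG x bt).
  + exact: bcZ.
  + move=> a /=; rewrite ler_wpM2r ?tail_cut_ge0// ler_expR.
    by rewrite (le_trans _ (GM (prepend a x)))// ler_norm.
Qed.

Lemma gibbs_measure : exists mu : probability (rseq R) R,
  forall w, holder alpha w -> \int[mu]_x w x = gibbs_mean w.
Proof.
have [C C0 hC] := gibbs_mean_tail.
apply: (daniell_representation halpha gibbs_meanD gibbs_meanZ gibbs_mean_ge0 (gibbs_mean_cst 1)).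
by move=> s; exact: (tight_cover hfpos hfcont hfint halpha gibbs_meanD gibbs_meanZ
  gibbs_mean_ge0 (gibbs_mean_cst 1) C0 hC).
Qed.

Context (mu : probability (rseq R) R).
Hypothesis muE : forall w, holder alpha w -> \int[mu]_x w x = gibbs_mean w.

Lemma gibbs_ruelle phi : bounded_continuous phi ->
  \int[mu]_x P phi x = \int[mu]_x phi x.
Proof.
move=> bphi; have [cphi [M phiM]] := iffLR (bounded_continuousP phi) bphi.
have lH k : holder alpha (lipreg phi k) by exact: (holder_lipreg phiM).
have [MG MG0 GM] := holder_bounded halpha hG.
have h1 := Rintegral_bc_cvg (mu := mu) (g_ := lipreg phi) (g := phi) (M := M)
  (fun k => holder_bc halpha (lH k)) (fun k x => lipreg_norm phiM k x)
  (fun x => lipreg_cvg phiM (x := x) cphi).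
have lbc k := holder_bc halpha (lH k).
have h2 := Rintegral_bc_cvg (mu := mu) (g_ := fun k => P (lipreg phi k)) (g := P phi)
  (M := expR MG * M) (fun k => bc_ruelle hfpos hfcont hfint halpha hG (lbc k))
  (fun k => ler_norm_ruelle hfpos hfcont hfint halpha hG (lbc k) GM (lipreg_norm phiM k))
  (ruelle_cvg hfpos hfcont hfint halpha hG lbc (lipreg_norm phiM)
    (fun x => lipreg_cvg phiM (x := x) cphi)).
rewrite -(cvg_lim _ h1)// -(cvg_lim _ h2)//; congr (limn _); apply/funext => k.
by rewrite !muE ?gibbs_mean_ruelle//; exact: (holder_ruelle hfpos hfcont hfint halpha hG).
Qed.

Lemma gibbs_dual : ruelle_dual f G mu mu.
Proof.
move=> phi bphi; rewrite !EFin_Rintegral_bc ?gibbs_ruelle//.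
exact: (bc_ruelle hfpos hfcont hfint halpha hG).
Qed.

Lemma gibbs_shift_invariant : shift_invariant mu.
Proof.
move=> B mB.
apply: (@probability_ext _ (distribution mu (@Defs.shift R)) mu alpha) => // w wH.
rewrite Rintegral_distribution_shift; last exact: (holder_bc halpha).
by rewrite !muE ?gibbs_mean_shift//; exact: (holder_shift halpha wH).
Qed.

(** The [nu]-integral of [iter n P w] does not depend on [n], while the integrands converge
    boundedly to the constant [gibbs_mean w]; so [nu] and [mu] agree on Hölder functions. *)
Lemma gibbs_dual_unique (nu : probability (rseq R) R) : ruelle_dual f G nu nu ->
  forall B, measurable B -> nu B = mu B.
Proof.
move=> nuG; apply: (probability_ext halpha) => w wH; rewrite muE//.
have step g : holder alpha g -> \int[nu]_x P g x = \int[nu]_x g x.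
  by move=> gH; rewrite /Rintegral (nuG _ (holder_bc halpha gH)).
have itH n := holder_iter_ruelle hfpos hfcont hfint halpha hG n wH.
have it n : \int[nu]_x iter n P w x = \int[nu]_x w x.
  by elim: n => // n IH; rewrite iterS step.
have [R0 hR] := gibbs_mean_gap wH; have [r0 r1] := andP r01.
have itM n x : `|iter n P w x| <= `|gibbs_mean w| + `|R0|.
  have := ler_normB (gibbs_mean w) (gibbs_mean w - iter n P w x).
  rewrite subKr => /le_trans; apply; rewrite lerD2l (le_trans (hR n x))//.
  rewrite (le_trans (ler_norm _))// normrM ler_piMr//.
  by rewrite ger0_norm ?exprn_ge0// exprn_ile1// ltW.
have h := Rintegral_bc_cvg (mu := nu) (g_ := fun n => iter n P w) (g := fun=> gibbs_mean w)
  (fun n => holder_bc halpha (itH n)) itM (fun x => gibbs_mean_cvg x wH).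
rewrite -[RHS](Rintegral_probability_cst nu) -(cvg_lim _ h)//.
under [X in limn X]eq_fun do rewrite it.
by rewrite lim_cst.
Qed.

(* [g] is only continuous, but [g >= P^n (lipreg g k)], which tends to the
   integral of [lipreg g k]. *)
Lemma ruelle_fixed_ge g x : bounded_continuous g -> (forall x, P g x = g x) ->
  \int[mu]_x g x <= g x.
Proof.
move=> bg Pg; have [cg [M gM]] := iffLR (bounded_continuousP g) bg.
have lH k : holder alpha (lipreg g k) by exact: (holder_lipreg gM).
have h1 := Rintegral_bc_cvg (mu := mu) (g_ := lipreg g) (g := g) (M := M)
  (fun k => holder_bc halpha (lH k)) (fun k x => lipreg_norm gM k x)
  (fun x => lipreg_cvg gM (x := x) cg).
rewrite -(cvg_lim _ h1)//; apply: limr_le; first by apply/cvg_ex; eexists; exact: h1.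
apply: nearW => k; rewrite muE//.
have h := gibbs_mean_cvg x (lH k).
rewrite -(cvg_lim _ h)//; apply: limr_le; first by apply/cvg_ex; eexists; exact: h.
apply: nearW => n; elim: n x {h} => [|n IH] x; first exact: (lipreg_le gM).
rewrite iterS -Pg; apply: (ler_ruelle hfpos hfcont hfint halpha hG) => //.
by apply: (holder_bc halpha); exact: holder_iter_ruelle.
Qed.

Lemma ruelle_fixed_cst g : bounded_continuous g -> (forall x, P g x = g x) ->
  forall x, g x = \int[mu]_x g x.
Proof.
move=> bg Pg x; apply/eqP; rewrite eq_le (ruelle_fixed_ge x bg Pg) andbT.
have bN := bcZ (-1) bg.
have PN y : P (fun x => -1 * g x) y = -1 * g y.
  by rewrite (ruelleZ hfpos hfcont hfint halpha hG)// Pg.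
have := ruelle_fixed_ge x bN PN.
by rewrite RintegralZl//; [lra|exact: bc_integrable_probability].
Qed.

End gibbs.

Lemma uniform_geo_cvg (R : realType) (F : nat -> rseq R -> R) (g : rseq R -> R)
    (K r : R) : 0 <= r < 1 -> (forall n x, `|g x - F n x| <= K * r ^+ n) ->
  {uniform, F @ \oo --> g}.
Proof.
move=> r01 h P /uniform_nbhs[E [entE EP]].
have [e /= e0 eE] : exists2 e : R, 0 < e & [set xy | ball xy.1 e xy.2] `<=` E.
  by move: entE; rewrite -entourage_ballE => -[e /= e0 eE]; exists e.
have [N hN] := geo_small K r01 e0; have [r0 r1] := andP r01.
have K0 : 0 <= K by have := h 0%N point; rewrite expr0 mulr1; apply: le_trans.
exists N => // n /= Nn; apply: EP => x _; apply: eE.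
rewrite /= /ball/= (le_lt_trans (h n x))// (le_lt_trans _ hN)//.
by rewrite ler_wpM2l// ler_wiXn2l// ltW.
Qed.

Lemma integral_mscale d (T : measurableType d) (R : realType)
    (mu : {measure set T -> \bar R}) (k : {nonneg R}) (g : T -> \bar R) :
  mu.-integrable setT g ->
  (\int[mscale k mu]_x g x = k%:num%:E * \int[mu]_x g x)%E.
Proof.
move=> ig; have mg := measurable_int _ ig.
rewrite [LHS]integralE [X in (_ * X)%E]integralE !ge0_integral_mscale//.
- by rewrite [RHS]muleBr// fin_num_adde_defr// integrable_pos_fin_num.
- exact: measurable_funeneg.
- exact: measurable_funepos.
Qed.

(** * Simplicity of the main eigenvalue *)

Section eigenvalue_simplicity.
Context {R : realType} (f : R -> R).
Hypotheses (hfpos : forall a, 0 < f a) (hfcont : continuous f)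
  (hfint : (\int[lebesgue_measure]_a (f a)%:E = 1)%E).
Context (alpha : R) (halpha : 0 < alpha <= 1).
Context (A : rseq R -> R) (hA : holder alpha A).
Local Notation L := (ruelle f A).
Context (lam m : R) (psi : rseq R -> R).
Hypotheses (lam0 : 0 < lam) (m0 : 0 < m) (mpsi : forall x, m <= psi x)
  (psiH : holder alpha psi) (psiE : forall x, L psi x = lam * psi x).
Local Notation P := (ruelle f (normalized_potential A lam psi)).
Context (mu : probability (rseq R) R).
Hypotheses
  (mu_ruelle : forall g, bounded_continuous g -> \int[mu]_x P g x = \int[mu]_x g x)
  (mu_fixed : forall g, bounded_continuous g -> (forall x, P g x = g x) ->
    forall x, g x = \int[mu]_x g x).

Let psi0 x : 0 < psi x. Proof. exact: lt_le_trans (mpsi x). Qed.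

Let bpsi : bounded_continuous psi. Proof. exact: (holder_bc halpha). Qed.

Let bV : bounded_continuous (fun x => (psi x)^-1).
Proof. by apply: (holder_bc halpha); exact: (holderV _ mpsi). Qed.

Lemma ruelle_normalized_div phi x : bounded_continuous phi ->
  P (fun y => phi y * (psi y)^-1) x = L phi x / (lam * psi x).
Proof.
move=> bphi.
rewrite (ruelle_normalized hfpos hfcont hfint halpha hA lam0 m0 mpsi psiH); last exact: bcM.
by congr (L _ x / _); apply/funext => y; rewrite mulrCA divff ?mulr1// gt_eqF.
Qed.

(** Induction on the power leaves [L phi = lam * phi + c * psi], a possible Jordan block. Then
    [g = phi / psi] satisfies [P g = g + c / lam]; integrating against the invariant [mu] forces
    [c = 0], and [g], now fixed by [P], is constant. *)
Lemma eigenvalue_simple : simple_eigenvalue L lam.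
Proof.
exists psi; split => //.
  move=> /(congr1 (@^~ point)) /= h.
  by have := psi0 point; rewrite h ltxx.
have NE h x : (L h - lam *: h) x = L h x - lam * h x by [].
move=> phi bphi; split=> [[k]|[c ->]]; last first.
  exists 1%N; apply/funext => x /=; rewrite NE.
  rewrite (_ : c *: psi = fun x => c * psi x)//.
  rewrite (ruelleZ hfpos hfcont hfint halpha hA)// psiE/=.
  by ring.
elim: k phi bphi => [|k IH] phi bphi.
  by move=> /= ->; exists 0; rewrite scale0r.
rewrite iterSr => /IH[].
  by apply: bcB; [exact: (bc_ruelle hfpos hfcont hfint halpha hA)|exact: bcZ].
move=> c hc; pose g x := phi x * (psi x)^-1.
have bg : bounded_continuous g by exact: bcM.
have LE x : L phi x = lam * phi x + c * psi x.
  have := congr1 (@^~ x) hc; rewrite NE /= => h.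
  have -> : c * psi x = L phi x - lam * phi x by rewrite h.
  by ring.
have PgE x : P g x = g x + c / lam.
  by rewrite ruelle_normalized_div// LE /g; field; rewrite !gt_eqF.
have c0 : c / lam = 0.
  have := mu_ruelle bg.
  have -> : P g = (fun x => g x + c / lam) by apply/funext.
  rewrite RintegralD//.
  - rewrite Rintegral_probability_cst => /eqP.
    by rewrite -subr_eq0 addrC addKr => /eqP.
  - exact: bc_integrable_probability.
  - by apply: bc_integrable_probability; exact: bc_cst.
have gE := mu_fixed bg (fun x => etrans (PgE x) (etrans (congr1 (+%R (g x)) c0) (addr0 _))).
exists (\int[mu]_x g x); apply/funext => x.
rewrite (_ : (_ *: psi) x = (\int[mu]_y g y) * psi x)// -(gE x).
by rewrite /g divfK// gt_eqF.
Qed.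

End eigenvalue_simplicity.

Theorem theorem2p4 (R : realType) (alpha : R) (halpha : 0 < alpha <= 1)
    (f : R -> R) (hfpos : forall a, 0 < f a) (hfcont : continuous f)
    (hfint : (\int[lebesgue_measure]_a (f a)%:E = 1)%E)
    (A : rseq R -> R) (hA : holder alpha A) :
  exists (lam : {posnum R}) (psi : rseq R -> R),
    [/\ holder alpha psi,
        (forall x, 0 < psi x),
        (forall x, ruelle f A psi x = lam%:num * psi x) &
        simple_eigenvalue (ruelle f A) lam%:num] /\
    let Abar := normalized_potential A lam%:num psi in
    exists mu : probability (rseq R) R,
      [/\ ruelle_dual f Abar mu mu,
          shift_invariant mu &
          forall nu : probability (rseq R) R, ruelle_dual f Abar nu nu ->
            forall B, measurable B -> nu B = mu B] /\
      exists (c : {posnum R}) (rho : probability (rseq R) R),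
        let psi' : rseq R -> R := fun x => c%:num * psi x in
        [/\ (forall B, measurable B ->
              (rho B = \int[mu]_(x in B) (psi' x)^-1%:E)%E),
            ruelle_dual f A rho (mscale lam%:num%:nng rho) &
            forall w : rseq R -> R, holder alpha w ->
              {uniform, (fun n => iter n (ruelle f Abar) w) @ \oo -->
                 (fun=> \int[mu]_x w x)} /\
              {uniform, (fun n x => iter n (ruelle f A) w x / lam%:num ^+ n)
                 @ \oo --> (fun x => psi' x * \int[rho]_x w x)}].

Proof.
have [lam [m [r [psi [[lam0 m0 mpsi psiH psiE] [r01 mix]]]]]] :=
  ruelle_perron_frobenius hfpos hfcont hfint halpha hA.
have psi0 x : 0 < psi x by exact: lt_le_trans (mpsi x).
have bpsi := holder_bc halpha psiH.
have VH := holderV m0 mpsi psiH.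
have bV := holder_bc halpha VH.
have GH := holder_normalized halpha hA lam m0 mpsi psiH.
have Pc := normalized_cst hfpos hfcont hfint halpha hA lam0 m0 mpsi psiH psiE.
have [mu muE] := gibbs_measure hfpos hfcont hfint halpha GH Pc r01 mix.
have muP := gibbs_ruelle hfpos hfcont hfint halpha GH r01 mix muE.
have muF := ruelle_fixed_cst hfpos hfcont hfint halpha GH r01 mix muE.
exists (PosNum lam0), psi; split.
  split => //.
  exact: (eigenvalue_simple hfpos hfcont hfint halpha hA lam0 m0 mpsi psiH psiE muP muF).
move=> Abar; exists mu; split.
  split.
  - exact: (gibbs_dual hfpos hfcont hfint halpha GH r01 mix muE).
  - exact: (gibbs_shift_invariant hfpos hfcont hfint halpha GH Pc r01 mix muE).
  - exact: (gibbs_dual_unique hfpos hfcont hfint halpha GH r01 mix muE).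
(* The suitable multiple is [c * psi], as [1 / (c * psi)] then has integral 1. Passing to it would
   not change [Abar], since [ln c] cancels. *)
pose c := \int[mu]_x (psi x)^-1.
have [M M0 psiM] := holder_bounded halpha psiH.
have c0 : 0 < c.
  rewrite (@lt_le_trans _ _ M^-1) ?invr_gt0//.
  rewrite -[leLHS](Rintegral_probability_cst mu); apply: le_Rintegral => //.
  - by apply: bc_integrable_probability; exact: bc_cst.
  - exact: bc_integrable_probability.
  - move=> x _; rewrite lef_pV2 ?posrE//.
    by rewrite (le_trans (ler_norm _)).
have bcV : bounded_continuous (fun x => (c * psi x)^-1).
  have -> : (fun x => (c * psi x)^-1) = (fun x => c^-1 * (psi x)^-1).
    by apply/funext => x; rewrite invfM.
  exact: bcZ.
have hint : (\int[mu]_x (c * psi x)^-1%:E = 1)%E.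
  rewrite EFin_Rintegral_bc//; congr (_%:E).
  under eq_Rintegral do rewrite invfM.
  rewrite RintegralZl//; last exact: bc_integrable_probability.
  by rewrite -/c mulVf// gt_eqF.
have mcV : measurable_fun setT (fun x => (c * psi x)^-1).
  by apply: continuous_measurable_rseq; case: bcV.
have cV0 x : 0 <= (c * psi x)^-1 by rewrite invr_ge0 mulr_ge0// ltW.
have [rho rhoE] := density_probability mcV cV0 hint.
have rhoI g : bounded_continuous g -> \int[rho]_x g x = \int[mu]_x (g x * (c * psi x)^-1).
  move=> bg; rewrite /Rintegral; congr fine.
  by apply: integral_density => //; exact: bc_integrable_probability.
exists (PosNum c0), rho => psi'; split.
- by move=> B mB; rewrite rhoE.
- move=> phi bphi.
  have bL := bc_ruelle hfpos hfcont hfint halpha hA bphi.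
  rewrite integral_mscale; last exact: bc_integrable_probability.
  rewrite !EFin_Rintegral_bc// -EFinM; congr (_%:E).
  (* Against [rho], [phi] integrates to [c^-1] times the [mu]-integral of [g], and [ruelle f A phi]
     to [lam / c] times that of [ruelle f Abar g]; the last two [mu]-integrals are equal by
     invariance. *)
  pose g x := phi x * (psi x)^-1; have bg : bounded_continuous g by exact: bcM.
  have bPg := bc_ruelle hfpos hfcont hfint halpha GH bg.
  have phiI : \int[rho]_x phi x = c^-1 * \int[mu]_x g x.
    rewrite rhoI// -RintegralZl//; last exact: bc_integrable_probability.
    by apply: eq_Rintegral => x _; rewrite /g invfM; ring.
  have LphiI : \int[rho]_x ruelle f A phi x = lam / c * \int[mu]_x ruelle f Abar g x.
    rewrite rhoI// -RintegralZl//; last exact: bc_integrable_probability.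
    apply: eq_Rintegral => x _.
    rewrite (ruelle_normalized_div hfpos hfcont hfint halpha hA lam0 m0 mpsi psiH)//.
    by field; rewrite !gt_eqF.
  by rewrite phiI LphiI muP// mulrA.
- move=> w wH; split.
    have [R0 hR] := gibbs_mean_gap r01 mix wH.
    by apply: (uniform_geo_cvg r01 (K := R0)) => n x; rewrite muE.
  have gH := holderM halpha wH VH; have bg := holder_bc halpha gH.
  have [R0 hR] := gibbs_mean_gap r01 mix gH.
  (* The rescaled iterates are [psi] times the iterates of the normalized operator on [w / psi], so
     the error picks up the bound [M] of [psi]. *)
  apply: (uniform_geo_cvg r01 (K := M * R0)) => n x /=.
  have -> : \int[rho]_x w x = c^-1 * gibbs_mean f Abar (fun x => w x * (psi x)^-1).
    rewrite rhoI; last exact: (holder_bc halpha).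
    rewrite -muE// -RintegralZl//; last exact: bc_integrable_probability.
    by apply: eq_Rintegral => y _; rewrite invfM; ring.
  have -> : iter n (ruelle f A) w x / lam ^+ n =
      psi x * iter n (ruelle f Abar) (fun x => w x * (psi x)^-1) x.
    rewrite (iter_normalized hfpos hfcont hfint halpha hA lam0 m0 mpsi psiH)//.
    have -> : (fun y => psi y * (w y * (psi y)^-1)) = w.
      by apply/funext => y; rewrite mulrCA divff ?mulr1// gt_eqF.
    by field; rewrite !gt_eqF// exprn_gt0.
  rewrite /psi' /= (_ : c * psi x * _ = psi x * gibbs_mean f Abar (fun x => w x * (psi x)^-1)); last first.
    by field; rewrite gt_eqF.
  by rewrite -mulrBr normrM -mulrA ler_pM.
Qed.
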